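(* Suppose that either $\mathcal A$ is an S-assembler and $\mathcal P\not\simeq\varnothing$, or $\mathcal A$ is an EA-assembler and $\mathrm{vol}(\mathcal P)>0$, where $\mathcal P$ is an object of $\mathcal{UG}(\mathcal A)$. Then $\mathrm{Aut}_{\mathcal{UG}(\mathcal A)}(\mathcal P)$ is quasi-perfect, i.e. its commutator subgroup is perfect.
   Context: Assemblers. Let $\mathcal A$ be a small Grothendieck site: a small category with a distinguished collection of sieves over every object satisfying the axioms of a Grothendieck topology. A family $\{P_i\to P\}_{i\in I}$ is a covering family if the sieve of all morphisms to $P$ factoring through some $P_i\to P$ is distinguished. Composing a covering family of $P$ with covering families of each $P_i$ gives a covering family of $P$, called a refinement of the original. Two morphisms $P_1\to P$, $P_2\to P$ are disjoint if $P_1\times_PP_2$ exists and is initial; a family is disjoint if its members are pairwise disjoint. A cover of $P$ is a finite disjoint covering family. $\mathcal A$ is an assembler if: (I) it has an initial object $\varnothing$ and the empty family is a cover of $\varnothing$; (R) every two covers of an object have a common refinement; (M) every morphism is a monomorphism. Categories. $\mathcal W(\mathcal A)$ has as objects finite tuples $\mathcal P=(I,\{P_i\}_{i\in I})$ of objects of $\mathcal A$; a morphism $(I,\{P_i\})\to(J,\{Q_j\})$ is a map $\phi\colon I\to J$ with morphisms $f(i)\colon P_i\to Q_{\phi(i)}$ such that $\{f(i)\}_{i\in\phi^{-1}(j)}$ is a cover of $Q_j$ for each $j$. It is symmetric monoidal under disjoint union $\sqcup$, with unit the empty tuple $\varnothing$. The scissors congruence groupoid $\mathcal G(\mathcal A)=\mathcal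 W(\mathcal A)[\mathcal W(\mathcal A)^{-1}]$ has the same objects, and its morphisms (scissors congruences) $\mathcal P\to\mathcal Q$ are equivalence classes of spans $\mathcal P\leftarrow\mathcal R\to\mathcal Q$ in $\mathcal W(\mathcal A)$, two spans being equivalent if they become equal after refining the middle terms to a common object; it inherits $\sqcup$. Write $\mathcal P\simeq\mathcal Q$ if they are isomorphic in $\mathcal G(\mathcal A)$. $\mathcal{UG}(\mathcal A)$ is the category of scissors embeddings: it has the same objects, and morphisms $\mathcal P\to\mathcal Q$ are equivalence classes of morphisms $\mathcal P\sqcup\mathcal P'\to\mathcal Q$ in $\mathcal G(\mathcal A)$ modulo isomorphisms of $\mathcal P'$. One has $\mathrm{Aut}_{\mathcal{UG}(\mathcal A)}(\mathcal P)=\mathrm{Aut}_{\mathcal G(\mathcal A)}(\mathcal P)$, the scissors automorphism group of $\mathcal P$. S-assembler: an assembler satisfying (S) for all $\mathcal P,\mathcal Q\not\simeq\varnothing$ there exists $\mathcal P'\not\simeq\varnothing$ with $\mathcal P\sqcup\mathcal P'\simeq\mathcal Q$. EA-assembler: let $(\mathbf R,\ge)$ be an ordered abelian group. A volume function on $\mathcal A$ is a function $\mathrm{vol}\colon\mathrm{ob}(\mathcal A)\to\mathbf R_{\ge0}$ with $\mathrm{vol}(P)=\sum_i\mathrm{vol}(P_i)$ for every cover $\{P_i\to P\}_{i\in I}$; extend it to tuples by $\mathrm{vol}(\mathcal P)=\sum_{i\in I}\mathrm{vol}(P_i)$. An EA-assembler is an assembler with a volume function such that: (E) if $\mathrm{vol}(\mathcal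 P)<\mathrm{vol}(\mathcal Q)$ there is a $\mathcal P'$ with $\mathcal P\sqcup\mathcal P'\simeq\mathcal Q$; (A) given $\mathcal P$ with $\mathrm{vol}(\mathcal P)>0$, every $\mathcal Q$ admits a (finite) cover $\{\mathcal Q_i\}$ with $2\,\mathrm{vol}(\mathcal Q_i)\le\mathrm{vol}(\mathcal P)$ for each $i$. *)

(* Defs.v *)
From HB Require Import structures.
From mathcomp Require Import all_boot order ssralg orderedzmod.
From mathcomp Require Import boolp classical_sets.

Set Implicit Arguments.
Unset Strict Implicit.
Unset Printing Implicit Defensive.

Import GRing.Theory.

Declare Scope cat_scope.
Delimit Scope cat_scope with cat.
Local Open Scope cat_scope.

Reserved Notation "g ∘ f" (at level 40, left associativity).
Reserved Notation "P ≃ Q" (at level 70, no associativity).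

Record category := Category {
  obj :> Type;
  hom : obj -> obj -> Type;
  idm : forall X, hom X X;
  compm : forall X Y Z, hom Y Z -> hom X Y -> hom X Z;
  comp1m : forall X Y (f : hom X Y), compm (idm Y) f = f;
  compm1 : forall X Y (f : hom X Y), compm f (idm X) = f;
  compmA : forall X Y Z T (h : hom Z T) (g : hom Y Z) (f : hom X Y),
    compm h (compm g f) = compm (compm h g) f }.

Arguments hom {c} X Y.
Arguments idm {c} X.
Arguments compm {c X Y Z} g f.
Arguments comp1m {c X Y} f.
Arguments compm1 {c X Y} f.
Arguments compmA {c X Y Z T} h g f.

Notation "g ∘ f" := (compm g f) : cat_scope.

Section CategoryNotions.
Variable C : category.
Implicit Types X Y Z D : C.

Definition is_mono X Y (f : hom X Y) : Prop :=
  forall Z (u v : hom Z X), f ∘ u = f ∘ v -> u = v.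

Definition is_initial X : Prop := forall Y, exists! f : hom X Y, True.

Definition is_pullback X Y Z (f : hom X Z) (g : hom Y Z)
    D (p : hom D X) (q : hom D Y) : Prop :=
  f ∘ p = g ∘ q /\
  forall T (u : hom T X) (v : hom T Y), f ∘ u = g ∘ v ->
    exists! h : hom T D, p ∘ h = u /\ q ∘ h = v.

Definition disjoint_arrows X Y Z (f : hom X Z) (g : hom Y Z) : Prop :=
  exists D (p : hom D X) (q : hom D Y), is_pullback f g p q /\ is_initial D.

Definition isomorphic X Y : Prop :=
  exists (f : hom X Y) (g : hom Y X), g ∘ f = idm X /\ f ∘ g = idm Y.

End CategoryNotions.

Record aut (C : category) (X : C) := Aut {
  aut_hom : hom X X;
  aut_inv : hom X X;
  aut_invK : aut_inv ∘ aut_hom = idm X;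
  aut_homK : aut_hom ∘ aut_inv = idm X }.

Section AutGroup.
Variables (C : category) (X : C).
Implicit Types a b c : aut X.

Lemma aut_ext a b : aut_hom a = aut_hom b -> a = b.
Proof.
case: a b => [f f' f'f ff'] [g g' g'g gg'] /= efg; subst g.
have e : f' = g' by rewrite -[f']comp1m -g'g -compmA ff' compm1.
by subst g'; congr Aut; exact: Prop_irrelevance.
Qed.

Definition aut_one : aut X := Aut (comp1m (idm X)) (comp1m (idm X)).

Definition aut_invg a : aut X := Aut (aut_homK a) (aut_invK a).

Fact aut_mul_invK a b :
  (aut_inv b ∘ aut_inv a) ∘ (aut_hom a ∘ aut_hom b) = idm X.
Proof.
by rewrite compmA -(compmA (aut_inv b)) aut_invK compm1 aut_invK.
Qed.

Fact aut_mul_homK a b :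
  (aut_hom a ∘ aut_hom b) ∘ (aut_inv b ∘ aut_inv a) = idm X.
Proof.
by rewrite compmA -(compmA (aut_hom a)) aut_homK compm1 aut_homK.
Qed.

Definition aut_mul a b : aut X := Aut (aut_mul_invK a b) (aut_mul_homK a b).

Fact aut_mulA : associative aut_mul.
Proof. by move=> a b c; apply: aut_ext; rewrite /= compmA. Qed.

Fact aut_mul1 : left_id aut_one aut_mul.
Proof. by move=> a; apply: aut_ext; rewrite /= comp1m. Qed.

Fact aut_mulr1 : right_id aut_one aut_mul.
Proof. by move=> a; apply: aut_ext; rewrite /= compm1. Qed.

Fact aut_mulV : left_inverse aut_one aut_invg aut_mul.
Proof. by move=> a; apply: aut_ext; rewrite /= aut_invK. Qed.

Fact aut_mulrV : right_inverse aut_one aut_invg aut_mul.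
Proof. by move=> a; apply: aut_ext; rewrite /= aut_homK. Qed.

HB.instance Definition _ := gen_eqMixin (aut X).
HB.instance Definition _ := gen_choiceMixin (aut X).
HB.instance Definition _ := isGroup.Build (aut X)
  aut_mulA aut_mul1 aut_mulr1 aut_mulV aut_mulrV.

End AutGroup.

Section QuasiPerfect.
Local Open Scope classical_set_scope.
Variable G : groupType.

Definition commutator_subgroup (H : set G) : set G :=
  smallest (fun K : set G => group_closed (mem K))
           [set [~ x, y]%g | x in H & y in H].

Definition perfect (H : set G) : Prop := commutator_subgroup H = H.

Definition quasi_perfect : Prop := perfect (commutator_subgroup [set: G]).

End QuasiPerfect.

Section Quotient.
Variables (T : Type) (R : T -> T -> Prop).

Definition quot := {c : T -> Prop | exists x, c = R x}.

Definition quot_pi (x : T) : quot := exist _ (R x) (ex_intro _ x erefl).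

Definition quot_repr (c : quot) : T := sval (cid (svalP c)).

Lemma quot_reprK c : quot_pi (quot_repr c) = c.
Proof.
rewrite /quot_repr /quot_pi; case: c => c c_cl /=.
case: cid => x /= ex; subst c; congr exist; exact: Prop_irrelevance.
Qed.

Hypothesis Rrefl : forall x, R x x.
Hypothesis Rsym : forall x y, R x y -> R y x.
Hypothesis Rtrans : forall x y z, R x y -> R y z -> R x z.

Lemma quot_piP x y : quot_pi x = quot_pi y <-> R x y.
Proof.
split=> [[/(congr1 (fun c => c y)) ->] //|xy].
apply: eq_exist; apply/funext => z; apply/propext.
by split=> [xz|yz]; [apply: Rtrans (Rsym xy) xz|apply: Rtrans xy yz].
Qed.

Lemma quot_pi_repr x : R (quot_repr (quot_pi x)) x.
Proof. by apply/quot_piP; rewrite quot_reprK. Qed.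

End Quotient.

Section Sites.
Variable C : category.

Definition presieve (X : C) := forall Y, hom Y X -> Prop.

Definition is_sieve (X : C) (S : presieve X) : Prop :=
  forall Y Z (f : hom Y X) (g : hom Z Y), S Y f -> S Z (f ∘ g).

Definition pullback_sieve (X Y : C) (f : hom Y X) (S : presieve X) :
  presieve Y := fun Z g => S Z (f ∘ g).

Record is_topology (J : forall X, presieve X -> Prop) : Prop := IsTopology {
  top_sieve : forall X (S : presieve X), J X S -> is_sieve S;
  top_max : forall X, J X (fun _ _ => True);
  top_pullback : forall X (S : presieve X) Y (f : hom Y X),
    J X S -> J Y (pullback_sieve f S);
  top_trans : forall X (S R : presieve X), J X S -> is_sieve R ->
    (forall Y (f : hom Y X), S Y f -> J Y (pullback_sieve f R)) -> J X R }.

Definition generated_sieve (X : C) I (P : I -> C) (f : forall i, hom (P i) X) :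
  presieve X := fun Y g => exists i (h : hom Y (P i)), g = f i ∘ h.

Definition disjoint_family (X : C) I (P : I -> C) (f : forall i, hom (P i) X) :=
  forall i j, i <> j -> disjoint_arrows (f i) (f j).

End Sites.

(** Index sets live in [Set]: tuples indexed by an arbitrary [finType] would
    form a type too large for [aut] to be a [choiceType]. *)
Record finSet := FinSet { fin_sort :> Set; fin_class : Finite fin_sort }.

HB.instance Definition _ (I : finSet) :=
  Finite.copy (fin_sort I) (Finite.Pack (fin_class I)).

Definition finSet_void : finSet := @FinSet void (Finite.class void).

Definition finSet_sum (I J : finSet) : finSet :=
  @FinSet (fin_sort I + fin_sort J)%type
          (Finite.class (fin_sort I + fin_sort J)%type).

Definition finSet_sigT (J : finSet) (K : J -> finSet) : finSet :=
  @FinSet {j : fin_sort J & fin_sort (K j)}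
          (Finite.class {j : fin_sort J & fin_sort (K j)}).

Definition finSet_sub (I : finSet) (p : pred I) : finSet :=
  @FinSet {i : fin_sort I | p i} (Finite.class {i : fin_sort I | p i}).

Definition fiber (I J : finSet) (phi : I -> J) (j : J) : finSet :=
  finSet_sub (fun i => phi i == j).

Definition fiber_arrow (C : category) (I J : finSet) (P : I -> C) (Q : J -> C)
    (phi : I -> J) (f : forall i, hom (P i) (Q (phi i))) (j : J)
    (x : fiber phi j) : hom (P (val x)) (Q j) :=
  ecast k (hom (P (val x)) (Q k)) (eqP (valP x)) (f (val x)).

Section Covers.
Variables (C : category) (J : forall X : C, presieve X -> Prop).

Definition covering_family (X : C) I (P : I -> C) (f : forall i, hom (P i) X) :=
  J (generated_sieve f).

Definition is_cover (X : C) (I : finSet) (P : I -> C)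
    (f : forall i, hom (P i) X) : Prop :=
  covering_family f /\ disjoint_family f.

(* [r] arises from [f] by composing it with a covering family of each member. *)
Definition is_refinement (X : C) (I K : finSet) (P : I -> C) (R : K -> C)
    (f : forall i, hom (P i) X) (r : forall k, hom (R k) X) : Prop :=
  exists (alpha : K -> I) (a : forall k, hom (R k) (P (alpha k))),
    (forall i, covering_family (fiber_arrow a (j := i))) /\
    (forall k, r k = f (alpha k) ∘ a k).

End Covers.

Record assembler := Assembler {
  asm_cat :> category;
  asm_top : forall X : asm_cat, presieve X -> Prop;
  asm_topP : is_topology asm_top;
  asm_initial : exists X : asm_cat, is_initial X /\
    forall (P : finSet_void -> asm_cat) (f : forall i, hom (P i) X),
      is_cover asm_top f;
  asm_refinement : forall (X : asm_cat) (I1 I2 : finSet)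
    (P1 : I1 -> asm_cat) (P2 : I2 -> asm_cat)
    (f1 : forall i, hom (P1 i) X) (f2 : forall i, hom (P2 i) X),
    is_cover asm_top f1 -> is_cover asm_top f2 ->
    exists (K : finSet) (R : K -> asm_cat) (r : forall k, hom (R k) X),
      [/\ is_cover asm_top r, is_refinement asm_top f1 r
        & is_refinement asm_top f2 r];
  asm_mono : forall (X Y : asm_cat) (f : hom X Y), is_mono f }.

Arguments asm_top {a} X S.
Arguments asm_mono {a X Y} f Z u v.

Record ftuple (A : assembler) := FTuple {
  idx : finSet;
  piece : idx -> A }.

Arguments piece {A} f i.

Record whom (A : assembler) (P Q : ftuple A) := WHom {
  wmap : idx P -> idx Q;
  warr : forall i, hom (piece P i) (piece Q (wmap i));
  wcover : forall j : idx Q, is_cover asm_top (fiber_arrow warr (j := j)) }.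

Lemma existT_inj (J : finSet) (F : J -> Type) j (a b : F j) :
  existT F j a = existT F j b -> a = b.
Proof. exact: (@eq_from_Tagged J F j a b). Qed.

Section CoverTheory.
Variable A : assembler.
Implicit Types X Y Z : A.

Lemma top_sub X (S R : presieve X) :
  asm_top X S -> is_sieve R -> (forall Y f, S Y f -> R Y f) -> asm_top X R.
Proof.
move=> JS sR SR; apply: (top_trans (asm_topP A) JS sR) => Y f /SR Rf.
suff -> : pullback_sieve f R = fun _ _ => True by exact: top_max (asm_topP A) Y.
apply: functional_extensionality_dep => Z; apply/funext => g.
by apply/propext; split=> // _; exact: sR.
Qed.

Lemma top_empty X Y (f : hom Y X) :
  is_initial X -> asm_top Y (fun _ _ => False).
Proof.
move=> iX; have [X0 [_ cX0]] := asm_initial A.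
have [J0 _] := cX0 (fun i : void => match i with end)
                   (fun i : void => match i with end).
have [k _] := iX X0.
have J1 := top_pullback (asm_topP A) (k ∘ f) J0.
apply: (top_sub J1); first by [].
by move=> Z g [[]].
Qed.

Lemma disjoint_pre X Y Z X' Y' (f : hom X Z) (g : hom Y Z)
    (a : hom X' X) (b : hom Y' Y) :
  disjoint_arrows f g -> disjoint_arrows (f ∘ a) (g ∘ b).
Proof.
move=> [D [p [q [[e univ] iD]]]].
have [p' _] := iD X'; have [q' _] := iD Y'.
have init W (u v : hom D W) : u = v.
  by have [w [_ uw]] := iD W; rewrite -(uw u I) -(uw v I).
exists D, p', q'; split=> //; split; first exact: init.
move=> T u v; rewrite -!compmA => /univ[h [[ph qh] _]].
have p'h : p' ∘ h = u.
  by apply: (asm_mono a); rewrite compmA -ph; congr (_ ∘ _); exact: init.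
have q'h : q' ∘ h = v.
  by apply: (asm_mono b); rewrite compmA -qh; congr (_ ∘ _); exact: init.
exists h; split=> // h' [p'h' _].
by apply: (asm_mono p'); rewrite p'h p'h'.
Qed.

Lemma disjoint_post X Y Z Z' (m : hom Z Z') (f : hom X Z) (g : hom Y Z) :
  disjoint_arrows f g -> disjoint_arrows (m ∘ f) (m ∘ g).
Proof.
move=> [D [p [q [[e univ] iD]]]]; exists D, p, q; split=> //; split.
  by rewrite -!compmA e.
by move=> T u v; rewrite -!compmA => /(asm_mono m); exact: univ.
Qed.

Lemma disjoint_post_inv X Y Z Z' (m : hom Z Z') (f : hom X Z) (g : hom Y Z) :
  disjoint_arrows (m ∘ f) (m ∘ g) -> disjoint_arrows f g.
Proof.
move=> [D [p [q [[e univ] iD]]]]; exists D, p, q; split=> //; split.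
  by apply: (asm_mono m); rewrite !compmA.
by move=> T u v fu; apply: univ; rewrite -!compmA fu.
Qed.

(* [f] maps the piece [i] into the piece [j] by [a]. *)
Definition arrow_at (I J : finSet) (P : I -> A) (Q : J -> A) (phi : I -> J)
    (f : forall i, hom (P i) (Q (phi i))) i j (a : hom (P i) (Q j)) : Prop :=
  existT (fun k => hom (P i) (Q k)) (phi i) (f i) = existT _ j a.

Section Fibers.
Variables (I J : finSet) (P : I -> A) (Q : J -> A) (phi : I -> J).
Variable f : forall i, hom (P i) (Q (phi i)).

Lemma arrow_at_refl i : arrow_at f (f i).
Proof. by []. Qed.

Lemma arrow_atP i j (a : hom (P i) (Q j)) (F : forall j, hom (P i) (Q j) -> Prop) :
  arrow_at f a -> F _ (f i) -> F _ a.
Proof.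
move=> e; have ej : phi i = j := congr1 tag e; subst j.
by have -> : f i = a := existT_inj e.
Qed.

Lemma arrow_at_fun i j (a b : hom (P i) (Q j)) :
  arrow_at f a -> arrow_at f b -> a = b.
Proof.
move=> fa fb; suff /(@existT_inj J (fun k => hom (P i) (Q k))) :
  existT (fun k => hom (P i) (Q k)) j a = existT _ j b by [].
exact: etrans (esym fa) fb.
Qed.

Lemma fiber_arrow_at j (x : fiber phi j) : arrow_at f (fiber_arrow f x).
Proof.
rewrite /arrow_at /fiber_arrow; move: (eqP (valP x)) => e.
by move: (val x) e => i e; case: j / e {x}.
Qed.

Lemma arrow_at_fiber i j (a : hom (P i) (Q j)) : arrow_at f a ->
  exists x : fiber phi j,
    existT (fun i => hom (P i) (Q j)) (val x) (fiber_arrow f x) = existT _ i a.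
Proof.
move=> e; have ej : phi i = j := congr1 tag e; subst j.
have -> : a = f i := esym (existT_inj e).
exists (exist _ i (eqxx (phi i))); rewrite /fiber_arrow /=; congr existT.
by rewrite (eq_axiomK (eqP _)).
Qed.

Definition arrow_sieve j : presieve (Q j) := fun Y g =>
  exists i (a : hom (P i) (Q j)) (h : hom Y (P i)), arrow_at f a /\ g = a ∘ h.

Lemma arrow_sieveE j : arrow_sieve (j := j) = generated_sieve (fiber_arrow f (j := j)).
Proof.
apply: functional_extensionality_dep => Y; apply/funext => g; apply/propext.
split=> [[i [a [h [/arrow_at_fiber[x ex] ->]]]]|[x [h ->]]].
  have ei : val x = i := congr1 tag ex; subst i.
  by exists x, h; rewrite (existT_inj ex).
by exists (val x), (fiber_arrow f x), h; split=> //; exact: fiber_arrow_at.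
Qed.

Lemma arrow_sieve_sieve j : is_sieve (arrow_sieve (j := j)).
Proof.
move=> Y Z g k [i [a [h [fa ->]]]].
by exists i, a, (h ∘ k); rewrite compmA.
Qed.

Lemma fiber_disjointP j :
  disjoint_family (fiber_arrow f (j := j)) <->
  forall i i' (a : hom (P i) (Q j)) (a' : hom (P i') (Q j)),
    arrow_at f a -> arrow_at f a' -> i <> i' -> disjoint_arrows a a'.
Proof.
split=> [dis i i' a a' /arrow_at_fiber[x ex] /arrow_at_fiber[y ey] ii'|dis x y xy].
  have exi : val x = i := congr1 tag ex; subst i.
  have eyi : val y = i' := congr1 tag ey; subst i'.
  rewrite -(existT_inj ex) -(existT_inj ey); apply: dis => exy.
  by rewrite exy in ii'.
apply: dis; try exact: fiber_arrow_at.
by move=> /val_inj.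
Qed.

Lemma fiber_coverP :
  (forall j, is_cover asm_top (fiber_arrow f (j := j))) <->
  (forall j, asm_top (Q j) (arrow_sieve (j := j))) /\
  (forall j i i' (a : hom (P i) (Q j)) (a' : hom (P i') (Q j)),
    arrow_at f a -> arrow_at f a' -> i <> i' -> disjoint_arrows a a').
Proof.
split=> [cov|[cov dis] j].
  split=> j; first by rewrite arrow_sieveE; exact: (cov j).1.
  by have [_ /fiber_disjointP] := cov j.
split; first by rewrite /covering_family -arrow_sieveE.
by apply/fiber_disjointP; exact: dis.
Qed.

End Fibers.

End CoverTheory.

Section WCategory.
Variable A : assembler.
Implicit Types P Q R S T : ftuple A.

Lemma whom_ext P Q (f g : whom P Q) :
  (forall i, existT (fun j => hom (piece P i) (piece Q j)) (wmap f i) (warr f i)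
           = existT _ (wmap g i) (warr g i)) -> f = g.
Proof.
pose arrows := forall i, {j & hom (piece P i) (piece Q j)}.
pose cov (F : arrows) :=
  forall j, is_cover asm_top (fiber_arrow (fun i => projT2 (F i)) (j := j)).
have mkE (F G : arrows) (cF : cov F) (cG : cov G) :
    F = G -> WHom cF = WHom cG.
  by move=> e; subst G; congr WHom; exact: Prop_irrelevance.
case: f g => [phi f cf] [psi g cg] /= e.
apply: (mkE (fun i => existT _ (phi i) (f i)) (fun i => existT _ (psi i) (g i))
  cf cg).
exact: functional_extensionality_dep.
Qed.

Lemma whom_top P Q (f : whom P Q) j :
  asm_top (piece Q j) (arrow_sieve (warr f) (j := j)).
Proof. exact: ((fiber_coverP _).1 (wcover f)).1. Qed.

Lemma whom_disjoint P Q (f : whom P Q) j i i'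
    (a : hom (piece P i) (piece Q j)) (a' : hom (piece P i') (piece Q j)) :
  arrow_at (warr f) a -> arrow_at (warr f) a' -> i <> i' -> disjoint_arrows a a'.
Proof. exact: ((fiber_coverP _).1 (wcover f)).2. Qed.

Fact whom_id_cover P j : is_cover asm_top
  (fiber_arrow (P := piece P) (Q := piece P) (fun i => idm (piece P i)) (j := j)).
Proof.
move: j; apply/fiber_coverP; split=> j.
  apply: (top_sub (top_max (asm_topP A) _)); first exact: arrow_sieve_sieve.
  by move=> Y g _; exists j, (idm _), g; rewrite comp1m.
by move=> i i' a a' /(congr1 tag) /= ei /(congr1 tag) /= ei' []; rewrite ei ei'.
Qed.

Definition whom_id P : whom P P := WHom (@whom_id_cover P).

Lemma arrow_at_comp (I J K : finSet) (P : I -> A) (Q : J -> A) (R : K -> A)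
    (phi : I -> J) (psi : J -> K)
    (f : forall i, hom (P i) (Q (phi i))) (g : forall j, hom (Q j) (R (psi j)))
    i k (c : hom (P i) (R k)) :
  arrow_at (phi := fun i => psi (phi i)) (fun i => g (phi i) ∘ f i) c <->
  exists j (a : hom (P i) (Q j)) (b : hom (Q j) (R k)),
    [/\ arrow_at f a, arrow_at g b & c = b ∘ a].
Proof.
split=> [gf|[j [a [b [fa gb ->]]]]].
  pose F k (c : hom (P i) (R k)) :=
    exists j (a : hom (P i) (Q j)) (b : hom (Q j) (R k)),
      [/\ arrow_at f a, arrow_at g b & c = b ∘ a].
  by apply: (@arrow_atP _ _ _ _ _ _ _ _ _ _ F gf); exists (phi i), (f i), (g (phi i)).
pose F j (a : hom (P i) (Q j)) := forall b : hom (Q j) (R k), arrow_at g b ->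
  arrow_at (phi := fun i => psi (phi i)) (fun i => g (phi i) ∘ f i) (b ∘ a).
apply: (@arrow_atP _ _ _ _ _ _ _ _ _ _ F fa _ _ gb) => b' gb'.
pose F' k (b : hom (Q (phi i)) (R k)) :=
  arrow_at (phi := fun i => psi (phi i)) (fun i => g (phi i) ∘ f i) (b ∘ f i).
exact: (@arrow_atP _ _ _ _ _ _ _ _ _ _ F' gb').
Qed.

Fact whom_comp_cover P Q R (g : whom Q R) (f : whom P Q) k : is_cover asm_top
  (fiber_arrow (P := piece P) (Q := piece R) (phi := fun i => wmap g (wmap f i))
     (fun i => warr g (wmap f i) ∘ warr f i) (j := k)).
Proof.
move: k; apply/fiber_coverP; split=> k.
  apply: (top_trans (asm_topP A) (whom_top g k)); first exact: arrow_sieve_sieve.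
  move=> Y _ [j [b [h [gb ->]]]].
  apply: (top_sub (top_pullback (asm_topP A) h (whom_top f j))).
    move=> Z Z' u v; rewrite /pullback_sieve compmA; exact: arrow_sieve_sieve.
  move=> Z u [i [a [v [fa huv]]]].
  exists i, (b ∘ a), v; split; last by rewrite -!compmA huv.
  by apply/arrow_at_comp; exists j, a, b.
move=> i i' c c' /arrow_at_comp[j [a [b [fa gb ->]]]].
move=> /arrow_at_comp[j' [a' [b' [fa' gb' ->]]]] ii'.
have [ej|/eqP nj] := eqVneq j j'; last first.
  by apply: disjoint_pre; exact: whom_disjoint gb gb' nj.
subst j'; rewrite (arrow_at_fun gb' gb); apply: disjoint_post.
exact: whom_disjoint fa fa' ii'.
Qed.

Definition whom_comp P Q R (g : whom Q R) (f : whom P Q) : whom P R :=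
  WHom (whom_comp_cover g f).

Fact whom_comp1m P Q (f : whom P Q) : whom_comp (whom_id Q) f = f.
Proof. by apply: whom_ext => i /=; rewrite comp1m. Qed.

Fact whom_compm1 P Q (f : whom P Q) : whom_comp f (whom_id P) = f.
Proof. by apply: whom_ext => i /=; rewrite compm1. Qed.

Fact whom_compA P Q R S (h : whom R S) (g : whom Q R) (f : whom P Q) :
  whom_comp h (whom_comp g f) = whom_comp (whom_comp h g) f.
Proof. by apply: whom_ext => i /=; rewrite compmA. Qed.

Definition Wcat : category := Category whom_comp1m whom_compm1 whom_compA.

Section Glue.
Variables (P R : ftuple A) (f : whom P R).
Variables (K : idx R -> finSet) (D : forall j, K j -> A).
Variable alpha : forall j, K j -> fiber (wmap f) j.
Variable a : forall j (k : K j), hom (D k) (piece P (val (alpha k))).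
Hypothesis a_top : forall j x, asm_top (piece P (val x))
  (arrow_sieve (Q := fun y : fiber (wmap f) j => piece P (val y)) (@a j) (j := x)).
Hypothesis a_disjoint : forall j (x : fiber (wmap f) j) (k k' : K j)
  (c : hom (D k) (piece P (val x))) (c' : hom (D k') (piece P (val x))),
  arrow_at (Q := fun y : fiber (wmap f) j => piece P (val y)) (@a j) c ->
  arrow_at (Q := fun y : fiber (wmap f) j => piece P (val y)) (@a j) c' ->
  k <> k' -> disjoint_arrows c c'.

Definition glue_tuple : ftuple A :=
  @FTuple A (finSet_sigT K) (fun t => D (tagged t)).

Fact glue_cover i : is_cover asm_top
  (fiber_arrow (P := piece glue_tuple) (Q := piece P)
     (phi := fun t => val (alpha (tagged t))) (fun t => a (tagged t)) (j := i)).
Proof.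
move: i; apply/fiber_coverP; split=> i.
  pose x : fiber (wmap f) (wmap f i) := exist _ i (eqxx _).
  apply: (top_sub (a_top x)); first exact: arrow_sieve_sieve.
  move=> Y _ [k [c [h [ac ->]]]].
  pose t : idx glue_tuple := existT (fun j => fin_sort (K j)) (wmap f i) k.
  exists t, c, h; split=> //.
  pose F (x : fiber (wmap f) (wmap f i)) (c : hom (D k) (piece P (val x))) :=
    arrow_at (P := piece glue_tuple) (Q := piece P)
     (phi := fun t => val (alpha (tagged t))) (fun t => a (tagged t))
     (i := t) c.
  exact: (@arrow_atP _ _ _ _ _ _ _ _ _ _ F ac).
move=> t t' c c'.
have lift_at (s : idx glue_tuple) (d : hom (piece glue_tuple s) (piece P i)) :
    arrow_at (P := piece glue_tuple) (Q := piece P)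
     (phi := fun t => val (alpha (tagged t))) (fun t => a (tagged t)) d ->
    exists (y : fiber (wmap f) (tag s)) (d0 : hom (D (tagged s)) (piece P (val y))),
      arrow_at (Q := fun y : fiber (wmap f) (tag s) => piece P (val y)) (@a (tag s)) d0  /\
      existT (fun i => hom (D (tagged s)) (piece P i)) (val y) d0 = existT _ i d.
  by move=> e; exists (alpha (tagged s)), (a (tagged s)).
move=> /lift_at[y [d [ad ed]]] /lift_at[y' [d' [ad' ed']]].
case: t c y d ad ed => j k c [y ey] /= d ad ed.
case: t' c' y' d' ad' ed' => j' k' c' [y' ey'] /= d' ad' ed' tt'.
have e1 : y = i := congr1 tag ed; have e2 : y' = i := congr1 tag ed'.
subst y; subst y'.
have e3 : wmap f i = j := eqP ey; have e4 : wmap f i = j' := eqP ey'.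
subst j; subst j'.
rewrite (bool_irrelevance ey' ey) in ad'.
rewrite -(existT_inj ed) -(existT_inj ed').
apply: (a_disjoint ad ad') => ek; apply: tt'; by rewrite ek.
Qed.

Definition glue : whom glue_tuple P := WHom glue_cover.

End Glue.

Section Refine.
Variables (P X : ftuple A) (f : whom P X) (j : idx X).
Variables (K : finSet) (D : K -> A) (r : forall k, hom (D k) (piece X j)).
Hypothesis r_cover : is_cover asm_top r.
Variables (alpha : K -> fiber (wmap f) j).
Variable a : forall k : K, hom (D k) (piece P (val (alpha k))).
Hypothesis ra : forall k, r k = fiber_arrow (warr f) (alpha k) ∘ a k.

Lemma refine_disjoint (x : fiber (wmap f) j) (k k' : K)
  (c : hom (D k) (piece P (val x))) (c' : hom (D k') (piece P (val x))) :
  arrow_at (Q := fun y : fiber (wmap f) j => piece P (val y)) a c ->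
  arrow_at (Q := fun y : fiber (wmap f) j => piece P (val y)) a c' ->
  k <> k' -> disjoint_arrows c c'.
Proof.
have rE l (d : hom (D l) (piece P (val x))) :
    arrow_at (Q := fun y : fiber (wmap f) j => piece P (val y)) a d ->
    r l = fiber_arrow (warr f) x ∘ d.
  pose F (x : fiber (wmap f) j) (d : hom (D l) (piece P (val x))) :=
    r l = fiber_arrow (warr f) x ∘ d.
  by move=> ad; apply: (@arrow_atP _ _ _ _ _ _ _ _ _ _ F ad); exact: ra.
move=> /rE rc /rE rc' kk'.
apply: (@disjoint_post_inv _ _ _ _ _ (fiber_arrow (warr f) x)).
by rewrite -rc -rc'; exact: r_cover.2.
Qed.

End Refine.

Record wref P Q R (f : whom P R) (g : whom Q R) (j : idx R) := WRef {
  wrK : finSet;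
  wrD : wrK -> A;
  wr1 : wrK -> fiber (wmap f) j;
  wra1 : forall k, hom (wrD k) (piece P (val (wr1 k)));
  wr2 : wrK -> fiber (wmap g) j;
  wra2 : forall k, hom (wrD k) (piece Q (val (wr2 k)));
  wr_comm : forall k, fiber_arrow (warr f) (wr1 k) ∘ wra1 k =
                      fiber_arrow (warr g) (wr2 k) ∘ wra2 k;
  wr_top1 : forall x, asm_top (piece P (val x))
    (arrow_sieve (Q := fun y : fiber (wmap f) j => piece P (val y)) wra1 (j := x));
  wr_disjoint1 : forall x k k' (c : hom (wrD k) (piece P (val x)))
      (c' : hom (wrD k') (piece P (val x))),
    arrow_at (Q := fun y : fiber (wmap f) j => piece P (val y)) wra1 c ->
    arrow_at (Q := fun y : fiber (wmap f) j => piece P (val y)) wra1 c' ->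
    k <> k' -> disjoint_arrows c c';
  wr_top2 : forall x, asm_top (piece Q (val x))
    (arrow_sieve (Q := fun y : fiber (wmap g) j => piece Q (val y)) wra2 (j := x));
  wr_disjoint2 : forall x k k' (c : hom (wrD k) (piece Q (val x)))
      (c' : hom (wrD k') (piece Q (val x))),
    arrow_at (Q := fun y : fiber (wmap g) j => piece Q (val y)) wra2 c ->
    arrow_at (Q := fun y : fiber (wmap g) j => piece Q (val y)) wra2 c' ->
    k <> k' -> disjoint_arrows c c' }.

Lemma wref_exists P Q R (f : whom P R) (g : whom Q R) j : wref f g j.
Proof.
have /cid[K /cid[D /cid[r [cr reff refg]]]] :=
  asm_refinement (wcover f j) (wcover g j).
move: reff refg => /cid[al /cid[a [ca ra]]] /cid[be /cid[b [cb rb]]].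
apply: (@WRef _ _ _ _ _ _ K D al a be b).
- by move=> k; rewrite -ra -rb.
- by move=> x; rewrite arrow_sieveE; exact: ca.
- exact: refine_disjoint cr _ _ ra.
- by move=> x; rewrite arrow_sieveE; exact: cb.
- exact: refine_disjoint cr _ _ rb.
Qed.

Lemma whom_ore P Q R (f : hom (P : Wcat) R) (g : hom (Q : Wcat) R) :
  exists (T : Wcat) (u : hom T P) (v : hom T Q), f ∘ u = g ∘ v.
Proof.
pose ref j := wref_exists f g j.
exists (glue_tuple (fun j => @wrD _ _ _ _ _ _ (ref j))),
  (glue (fun j => @wr_top1 _ _ _ _ _ _ (ref j)) (fun j => @wr_disjoint1 _ _ _ _ _ _ (ref j))),
  (glue (fun j => @wr_top2 _ _ _ _ _ _ (ref j)) (fun j => @wr_disjoint2 _ _ _ _ _ _ (ref j))).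
apply: whom_ext => -[j k] /=; have abk := wr_comm k.
have /(congr1 (fun s => existT (fun l => hom (wrD k) (piece R l)) (tag s)
  (tagged s ∘ wra1 k))) /= -> := fiber_arrow_at (warr f) (wr1 k).
have /(congr1 (fun s => existT (fun l => hom (wrD k) (piece R l)) (tag s)
  (tagged s ∘ wra2 k))) /= -> := fiber_arrow_at (warr g) (wr2 k).
by congr existT.
Qed.

Lemma whom_cancel P Q R (f : hom (Q : Wcat) R) (u v : hom (P : Wcat) Q) :
  f ∘ u = f ∘ v -> exists (T : Wcat) (w : hom T P), u ∘ w = v ∘ w.
Proof.
move=> fuv.
pose same i := `[< existT (fun j => hom (piece P i) (piece Q j)) (wmap u i) (warr u i)
  = existT _ (wmap v i) (warr v i) >].
pose T : ftuple A := @FTuple A (finSet_sub same) (fun x => piece P (val x)).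
have cov i : is_cover asm_top (fiber_arrow (P := piece T) (Q := piece P)
    (phi := fun x : idx T => val x) (fun x => idm _) (j := i)).
  move: i; apply/fiber_coverP; split=> i; last first.
    move=> x x' a a' /(congr1 tag) /= ei /(congr1 tag) /= ei' []; apply: val_inj.
    by rewrite /= ei ei'.
  have [/= si|/asboolP nsi] := boolP (same i).
    apply: (top_sub (top_max (asm_topP A) _)); first exact: arrow_sieve_sieve.
    by move=> Y g _; exists (exist _ i si), (idm _), g; rewrite comp1m.
  suff Ji : asm_top (piece P i) (fun _ _ => False).
    by apply: (top_sub Ji) => //; exact: arrow_sieve_sieve.
  have : arrow_at (warr (whom_comp f u)) (warr f (wmap v i) ∘ warr v i).
    by rewrite [whom_comp f u]fuv.
  move=> /arrow_at_comp[j [a [b [ua fb e]]]].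
  have [ej|/eqP nj] := eqVneq j (wmap v i).
    subst j; case: nsi; rewrite ua; congr existT.
    apply: (asm_mono b); rewrite -e; congr (_ ∘ _).
    exact: arrow_at_fun (arrow_at_refl _ _) fb.
  have [X [p [q [[_ univ] iX]]]] := whom_disjoint fb (arrow_at_refl _ _) nj.
  by have [h _] := univ _ a (warr v i) (esym e); exact: top_empty h iX.
exists T, (WHom cov); apply: whom_ext => -[i si] /=.
by rewrite !compm1; exact/asboolP.
Qed.

End WCategory.

Section DisjointUnion.
Variable A : assembler.
Implicit Types P Q R S : ftuple A.

Definition tempty : ftuple A :=
  @FTuple A finSet_void (fun i : void => match i with end).

Definition tsum P Q : ftuple A :=
  @FTuple A (finSet_sum (idx P) (idx Q))
    (fun x => match x with inl i => piece P i | inr j => piece Q j end).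

Section WhomSum.
Variables (P P' Q Q' : ftuple A) (f : whom P Q) (g : whom P' Q').

Definition whom_sum_map (x : idx (tsum P P')) : idx (tsum Q Q') :=
  match x with inl i => inl (wmap f i) | inr j => inr (wmap g j) end.

Definition whom_sum_arr (x : idx (tsum P P')) :
    hom (piece (tsum P P') x) (piece (tsum Q Q') (whom_sum_map x)) :=
  match x with inl i => warr f i | inr j => warr g j end.

Lemma whom_sum_atl i j (a : hom (piece P i) (piece Q j)) :
  arrow_at (P := piece (tsum P P')) (Q := piece (tsum Q Q'))
    whom_sum_arr (i := inl i) (j := inl j) a <-> arrow_at (warr f) a.
Proof.
split=> [|fa].
  pose prj (s : {k & hom (piece P i) (piece (tsum Q Q') k)}) :
      {j & hom (piece P i) (piece Q j)} :=
    match s with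
    | existT (inl j) a => existT _ j a
    | existT (inr _) _ => existT _ (wmap f i) (warr f i)
    end.
  by move/(congr1 prj).
pose F j (a : hom (piece P i) (piece Q j)) :=
  arrow_at (P := piece (tsum P P')) (Q := piece (tsum Q Q'))
    whom_sum_arr (i := inl i) (j := inl j) a.
exact: (@arrow_atP _ _ _ _ _ _ _ _ _ _ F fa).
Qed.

Lemma whom_sum_atr i j (a : hom (piece P' i) (piece Q' j)) :
  arrow_at (P := piece (tsum P P')) (Q := piece (tsum Q Q'))
    whom_sum_arr (i := inr i) (j := inr j) a <-> arrow_at (warr g) a.
Proof.
split=> [|ga].
  pose prj (s : {k & hom (piece P' i) (piece (tsum Q Q') k)}) :
      {j & hom (piece P' i) (piece Q' j)} :=
    match s with
    | existT (inr j) a => existT _ j a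
    | existT (inl _) _ => existT _ (wmap g i) (warr g i)
    end.
  by move/(congr1 prj).
pose F j (a : hom (piece P' i) (piece Q' j)) :=
  arrow_at (P := piece (tsum P P')) (Q := piece (tsum Q Q'))
    whom_sum_arr (i := inr i) (j := inr j) a.
exact: (@arrow_atP _ _ _ _ _ _ _ _ _ _ F ga).
Qed.

Fact whom_sum_cover k : is_cover asm_top
  (fiber_arrow (P := piece (tsum P P')) (Q := piece (tsum Q Q'))
     whom_sum_arr (j := k)).
Proof.
move: k; apply/fiber_coverP; split=> [[j|j]|].
- apply: (top_sub (whom_top f j)).
    exact: (@arrow_sieve_sieve _ _ _ _ _ _ whom_sum_arr (inl j)).
  move=> Y _ [i [a [h [fa ->]]]].
  by exists (inl i), a, h; split=> //; apply/whom_sum_atl.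
- apply: (top_sub (whom_top g j)).
    exact: (@arrow_sieve_sieve _ _ _ _ _ _ whom_sum_arr (inr j)).
  move=> Y _ [i [a [h [ga ->]]]].
  by exists (inr i), a, h; split=> //; apply/whom_sum_atr.
move=> [j|j] [i|i] [i'|i'] a a';
  try (by move/(congr1 tag)); try (by move=> _ /(congr1 tag)).
- move=> /whom_sum_atl fa /whom_sum_atl fa' ii'.
  by apply: whom_disjoint fa fa' _ => e; apply: ii'; rewrite e.
- move=> /whom_sum_atr ga /whom_sum_atr ga' ii'.
  by apply: whom_disjoint ga ga' _ => e; apply: ii'; rewrite e.
Qed.

Definition whom_sum : whom (tsum P P') (tsum Q Q') := WHom whom_sum_cover.

End WhomSum.

Lemma whom_sum_id P Q : whom_sum (whom_id P) (whom_id Q) = whom_id (tsum P Q).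
Proof. by apply: whom_ext => -[]. Qed.

Lemma whom_sum_comp P P' Q Q' R R' (g : whom Q R) (g' : whom Q' R')
    (f : whom P Q) (f' : whom P' Q') :
  whom_sum (whom_comp g f) (whom_comp g' f') =
  whom_comp (whom_sum g g') (whom_sum f f').
Proof. by apply: whom_ext => -[]. Qed.

Section Relabel.
Variables (P Q : ftuple A) (phi : idx P -> idx Q).
Variable f : forall i, hom (piece P i) (piece Q (phi i)).
Hypothesis phi_inj : injective phi.
Hypothesis phi_surj : forall j, exists i, phi i = j.
Hypothesis f_split : forall i, exists g, f i ∘ g = idm _.

Fact relabel_cover j : is_cover asm_top (fiber_arrow f (j := j)).
Proof.
move: j; apply/fiber_coverP; split=> j; last first.
  move=> i i' a a' /(congr1 tag) /= ei /(congr1 tag) /= ei' [].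
  by apply: phi_inj; rewrite ei ei'.
apply: (top_sub (top_max (asm_topP A) _)); first exact: arrow_sieve_sieve.
have [i ei] := phi_surj j; subst j => Y g _; have [h fh] := f_split i.
by exists i, (f i), (h ∘ g); rewrite compmA fh comp1m.
Qed.

Definition relabel : whom P Q := WHom relabel_cover.
End Relabel.

Definition wassoc_map P Q R (x : idx (tsum P (tsum Q R))) :
    idx (tsum (tsum P Q) R) :=
  match x with
  | inl i => inl (inl i)
  | inr (inl j) => inl (inr j)
  | inr (inr k) => inr k
  end.

Definition wassoc_arr P Q R (x : idx (tsum P (tsum Q R))) :
    hom (piece (tsum P (tsum Q R)) x) (piece (tsum (tsum P Q) R) (wassoc_map x)) :=
  match x with
  | inl i => idm (piece P i)
  | inr (inl j) => idm (piece Q j)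
  | inr (inr k) => idm (piece R k)
  end.

Definition wassoc P Q R : whom (tsum P (tsum Q R)) (tsum (tsum P Q) R).
Proof.
apply: (relabel (phi := @wassoc_map P Q R) (f := @wassoc_arr P Q R)).
- by move=> [i|[i|i]] [j|[j|j]] //= [->].
- move=> [[i|j]|k]; [by exists (inl i)|by exists (inr (inl j))|].
  by exists (inr (inr k)).
- by move=> [i|[i|i]]; exists (idm _); rewrite comp1m.
Defined.

Definition wrunit P : whom (tsum P tempty) P.
Proof.
apply: (relabel
  (phi := fun x : idx (tsum P tempty) => match x with inl i => i | inr e => match e with end end)
  (f := fun x : idx (tsum P tempty) =>
     match x with inl i => idm (piece P i) | inr e => match e with end end)).
- by move=> [i|[]] [j|[]] //= ->.
- by move=> i; exists (inl i).
- by move=> [i|[]]; exists (idm _); rewrite comp1m.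
Defined.

Definition wlunit P : whom (tsum tempty P) P.
Proof.
apply: (relabel
  (phi := fun x : idx (tsum tempty P) => match x with inr i => i | inl e => match e with end end)
  (f := fun x : idx (tsum tempty P) =>
     match x with inr i => idm (piece P i) | inl e => match e with end end)).
- by move=> [[]|i] [[]|j] //= ->.
- by move=> i; exists (inr i).
- by move=> [[]|i]; exists (idm _); rewrite comp1m.
Defined.

Lemma wassoc_nat P P' Q Q' R R' (f : whom P P') (g : whom Q Q') (h : whom R R') :
  whom_comp (wassoc P' Q' R') (whom_sum f (whom_sum g h)) =
  whom_comp (whom_sum (whom_sum f g) h) (wassoc P Q R).
Proof.
by apply: whom_ext => -[i|[i|i]] /=; rewrite comp1m compm1.
Qed.

Lemma wrunit_nat P Q (f : whom P Q) :
  whom_comp (wrunit Q) (whom_sum f (whom_id tempty)) = whom_comp f (wrunit P).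
Proof. by apply: whom_ext => -[i|[]] /=; rewrite comp1m compm1. Qed.

Lemma wrunit_assoc P Q :
  whom_comp (wrunit (tsum P Q)) (wassoc P Q tempty) =
  whom_sum (whom_id P) (wrunit Q).
Proof. by apply: whom_ext => -[i|[i|[]]] /=; rewrite comp1m. Qed.

Lemma wtriangle P Q :
  whom_comp (whom_sum (wrunit P) (whom_id Q)) (wassoc P tempty Q) =
  whom_sum (whom_id P) (wlunit Q).
Proof. by apply: whom_ext => -[i|[[]|i]] /=; rewrite comp1m. Qed.

Lemma wpentagon P Q R S :
  whom_comp (wassoc (tsum P Q) R S) (wassoc P Q (tsum R S)) =
  whom_comp (whom_sum (wassoc P Q R) (whom_id S))
    (whom_comp (wassoc P (tsum Q R) S) (whom_sum (whom_id P) (wassoc Q R S))).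
Proof. by apply: whom_ext => -[i|[i|[i|i]]] /=; rewrite !comp1m. Qed.

End DisjointUnion.

Section Fractions.
Variable C : category.
Hypothesis ore : forall (X Y Z : C) (f : hom X Z) (g : hom Y Z),
  exists (T : C) (u : hom T X) (v : hom T Y), f ∘ u = g ∘ v.
Hypothesis cancel_right : forall (X Y Z : C) (f : hom Y Z) (u v : hom X Y),
  f ∘ u = f ∘ v -> exists (T : C) (w : hom T X), u ∘ w = v ∘ w.

Record span (X Y : C) := Span {
  apex : C;
  lleg : hom apex X;
  rleg : hom apex Y }.

Definition span_eq X Y (s t : span X Y) : Prop :=
  exists (T : C) (u : hom T (apex s)) (v : hom T (apex t)),
    lleg s ∘ u = lleg t ∘ v /\ rleg s ∘ u = rleg t ∘ v.

Definition frac X Y := quot (@span_eq X Y).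

Lemma span_eq_refl X Y (s : span X Y) : span_eq s s.
Proof. by exists (apex s), (idm _), (idm _). Qed.

Lemma span_eq_sym X Y (s t : span X Y) : span_eq s t -> span_eq t s.
Proof. by move=> [T [u [v [e e']]]]; exists T, v, u. Qed.

Lemma span_eq_trans X Y (s t r : span X Y) :
  span_eq s t -> span_eq t r -> span_eq s r.
Proof.
move=> [T [u [v [e1 e2]]]] [T' [u' [v' [e1' e2']]]].
have [U [a [b ab]]] := ore v u'.
exists U, (u ∘ a), (v' ∘ b); rewrite !compmA e1 e2 -e1' -e2' -!compmA ab //.
Qed.

Definition frac_pi X Y (s : span X Y) : frac X Y := quot_pi (@span_eq X Y) s.

Lemma frac_piP X Y (s t : span X Y) : frac_pi s = frac_pi t <-> span_eq s t.
Proof.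
by apply: quot_piP; [exact: span_eq_refl|exact: span_eq_sym|exact: span_eq_trans].
Qed.

Lemma frac_repr X Y (f : frac X Y) : frac_pi (quot_repr f) = f.
Proof. exact: quot_reprK. Qed.

Lemma fracP X Y (f : frac X Y) : exists s, f = frac_pi s.
Proof. by exists (quot_repr f); rewrite frac_repr. Qed.

Definition span_pre X Y (s : span X Y) T (u : hom T (apex s)) : span X Y :=
  Span (lleg s ∘ u) (rleg s ∘ u).

Lemma span_preP X Y (s : span X Y) T (u : hom T (apex s)) :
  frac_pi (span_pre u) = frac_pi s.
Proof. by apply/frac_piP; exists T, (idm _), u; rewrite /= !compm1. Qed.

(* The composite along a common refinement of the inner legs. *)
Definition span_comp X Y Z (t : span Y Z) (s : span X Y) : span X Z :=
  let: exist T Tuv := cid (ore (rleg s) (lleg t)) in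
  let: exist u uv := cid Tuv in
  let: exist v _ := cid uv in
  Span (lleg s ∘ u) (rleg t ∘ v).

Lemma span_compE X Y Z (t : span Y Z) (s : span X Y) T
    (u : hom T (apex s)) (v : hom T (apex t)) :
  rleg s ∘ u = lleg t ∘ v ->
  frac_pi (span_comp t s) = frac_pi (Span (lleg s ∘ u) (rleg t ∘ v)).
Proof.
move=> euv; rewrite /span_comp.
case: cid => T' Tuv; case: cid => u' uv'; case: cid => v' euv'.
apply/frac_piP; have [U [a [b ab]]] := ore u' u.
have [|V [w vw]] := @cancel_right _ _ _ (lleg t) (v' ∘ a) (v ∘ b).
  by rewrite !compmA -euv' -euv -!compmA ab.
exists V, (a ∘ w), (b ∘ w); split=> /=.
  by rewrite -!compmA (compmA u') ab -(compmA u).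
by move: vw; rewrite -!compmA => ->.
Qed.

Lemma span_comp_pre X Y Z (t : span Y Z) T (v : hom T (apex t))
    (s : span X Y) S (u : hom S (apex s)) :
  frac_pi (span_comp (span_pre v) (span_pre u)) = frac_pi (span_comp t s).
Proof.
have [U [a [b ab]]] := ore (rleg (span_pre u)) (lleg (span_pre v)).
rewrite (span_compE ab); symmetry.
move: ab => /=; rewrite -!compmA => ab.
by rewrite (span_compE ab).
Qed.

Lemma span_eq_pre X Y (s s' : span X Y) : span_eq s s' ->
  exists T (u : hom T (apex s)) (u' : hom T (apex s')), span_pre u = span_pre u'.
Proof. by move=> [T [u [v [e e']]]]; exists T, u, v; rewrite /span_pre e e'. Qed.

Definition frac_comp X Y Z (g : frac Y Z) (f : frac X Y) : frac X Z :=
  frac_pi (span_comp (quot_repr g) (quot_repr f)).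

Lemma frac_comp_pi X Y Z (t : span Y Z) (s : span X Y) :
  frac_comp (frac_pi t) (frac_pi s) = frac_pi (span_comp t s).
Proof.
have /frac_piP/span_eq_pre[T [v [v' ev]]] := frac_repr (frac_pi t).
have /frac_piP/span_eq_pre[S [u [u' eu]]] := frac_repr (frac_pi s).
by rewrite /frac_comp -(span_comp_pre v u) ev eu span_comp_pre.
Qed.

Lemma frac_compE X Y Z (t : span Y Z) (s : span X Y) T
    (u : hom T (apex s)) (v : hom T (apex t)) :
  rleg s ∘ u = lleg t ∘ v ->
  frac_comp (frac_pi t) (frac_pi s) = frac_pi (Span (lleg s ∘ u) (rleg t ∘ v)).
Proof. by move=> e; rewrite frac_comp_pi; exact: span_compE. Qed.

Definition frac_id X : frac X X := frac_pi (Span (idm X) (idm X)).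

Fact frac_comp1m X Y (f : frac X Y) : frac_comp (frac_id Y) f = f.
Proof.
have [[T l r] ->] := fracP f.
by rewrite (@frac_compE _ _ _ (Span _ _) (Span l r) T (idm T) r) /= ?compm1 ?comp1m.
Qed.

Fact frac_compm1 X Y (f : frac X Y) : frac_comp f (frac_id X) = f.
Proof.
have [[T l r] ->] := fracP f.
by rewrite (@frac_compE _ _ _ (Span l r) (Span _ _) T l (idm T)) /= ?compm1 ?comp1m.
Qed.

Fact frac_compA X Y Z W (h : frac Z W) (g : frac Y Z) (f : frac X Y) :
  frac_comp h (frac_comp g f) = frac_comp (frac_comp h g) f.
Proof.
have [s ->] := fracP f; have [t ->] := fracP g; have [r ->] := fracP h.
have [T [a [b ab]]] := ore (rleg s) (lleg t).
have [U [c [d cd]]] := ore (rleg t) (lleg r).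
have [V [p [q pq]]] := ore b c.
rewrite (frac_compE ab) (frac_compE cd).
rewrite (@frac_compE _ _ _ r (Span _ _) V p (d ∘ q)) /=; last first.
  by rewrite -compmA pq !compmA cd.
rewrite (@frac_compE _ _ _ (Span _ _) s V (a ∘ p) q) /=; last first.
  by rewrite compmA ab -!compmA pq.
by rewrite !compmA.
Qed.

(* The localization of [C] at all of its morphisms. *)
Definition fractions : category :=
  @Category C frac frac_id frac_comp frac_comp1m frac_compm1 frac_compA.

Definition frac_inv X Y (f : frac X Y) : frac Y X :=
  let s := quot_repr f in frac_pi (Span (rleg s) (lleg s)).

Lemma frac_inv_pi X Y (s : span X Y) :
  frac_inv (frac_pi s) = frac_pi (Span (rleg s) (lleg s)).
Proof.
rewrite /frac_inv; move: (frac_repr (frac_pi s)) => /frac_piP[T [u [v [e e']]]].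
by apply/frac_piP; exists T, u, v.
Qed.

Lemma frac_invK X Y (f : frac X Y) : frac_comp (frac_inv f) f = frac_id X.
Proof.
have [s ->] := fracP f; rewrite frac_inv_pi.
rewrite (@frac_compE _ _ _ (Span _ _) s _ (idm _) (idm _)) //= !compm1.
by apply/frac_piP; exists (apex s), (idm _), (lleg s); rewrite /= compm1 comp1m.
Qed.

Lemma frac_homK X Y (f : frac X Y) : frac_comp f (frac_inv f) = frac_id Y.
Proof.
have [s ->] := fracP f; rewrite frac_inv_pi.
rewrite (@frac_compE _ _ _ s (Span _ _) _ (idm _) (idm _)) //= !compm1.
by apply/frac_piP; exists (apex s), (idm _), (rleg s); rewrite /= compm1 comp1m.
Qed.

Definition frac_of X Y (f : hom X Y) : frac X Y := frac_pi (Span (idm X) f).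

Lemma frac_of_comp X Y Z (g : hom Y Z) (f : hom X Y) :
  frac_of (g ∘ f) = frac_comp (frac_of g) (frac_of f).
Proof. by rewrite (@frac_compE _ _ _ (Span _ g) (Span _ f) X (idm X) f) /= ?compm1 ?comp1m. Qed.

Lemma frac_piE X Y (s : span X Y) :
  frac_pi s = frac_comp (frac_of (rleg s)) (frac_inv (frac_of (lleg s))).
Proof.
case: s => T l r; rewrite /frac_of frac_inv_pi.
by rewrite (@frac_compE _ _ _ (Span (idm T) r) (Span l (idm T)) T (idm T) (idm T)) //= !compm1.
Qed.

End Fractions.

Section ScissorsCongruence.
Variable A : assembler.
Local Notation W := (Wcat A).

Definition Gcat : category := @fractions W (@whom_ore A) (@whom_cancel A).

Implicit Types P Q R S : Gcat.

Lemma gcompE (X Y Z : W) (t : span Y Z) (s : span X Y) T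
    (u : hom T (apex s)) (v : hom T (apex t)) :
  rleg s ∘ u = lleg t ∘ v ->
  (frac_pi t : hom (Y : Gcat) Z) ∘ (frac_pi s : hom (X : Gcat) Y) =
  frac_pi (Span (lleg s ∘ u) (rleg t ∘ v)).
Proof. by move=> uv; exact: (@frac_compE W (@whom_ore A) (@whom_cancel A) _ _ _ t s T u v uv). Qed.

Definition span_sum (P P' Q Q' : W) (s : span P Q) (t : span P' Q') :
    span (tsum P P' : W) (tsum Q Q' : W) :=
  @Span W _ _ (tsum (apex s) (apex t))
    (whom_sum (lleg s) (lleg t)) (whom_sum (rleg s) (rleg t)).

Definition gsum P P' Q Q' (f : hom P Q) (g : hom P' Q') :
    hom (tsum P P' : Gcat) (tsum Q Q' : Gcat) :=
  frac_pi (span_sum (quot_repr f) (quot_repr g)).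

Lemma gsum_pi (P P' Q Q' : W) (s : span P Q) (t : span P' Q') :
  gsum (frac_pi s : hom (P : Gcat) Q) (frac_pi t : hom (P' : Gcat) Q') =
  frac_pi (span_sum s t).
Proof.
have /(@frac_piP W (@whom_ore A) _ _ _ _)[T [u [v [e1 e2]]]] := frac_repr (frac_pi s).
have /(@frac_piP W (@whom_ore A) _ _ _ _)[T' [u' [v' [e1' e2']]]] := frac_repr (frac_pi t).
apply/(@frac_piP W (@whom_ore A) _ _ _ _); exists (tsum T T'), (whom_sum u u'), (whom_sum v v').
split=> /=.
  by rewrite -2!whom_sum_comp; congr whom_sum.
by rewrite -2!whom_sum_comp; congr whom_sum.
Qed.

Lemma gsum_comp P P' Q Q' R R' (g : hom Q R) (g' : hom Q' R')
    (f : hom P Q) (f' : hom P' Q') :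
  gsum (g ∘ f) (g' ∘ f') = gsum g g' ∘ gsum f f'.
Proof.
have [s ->] := fracP f; have [t ->] := fracP g.
have [s' ->] := fracP f'; have [t' ->] := fracP g'.
have [T [u [v uv]]] := @whom_ore A _ _ _ (rleg s) (lleg t).
have [T' [u' [v' uv']]] := @whom_ore A _ _ _ (rleg s') (lleg t').
rewrite (gcompE uv) (gcompE uv') !gsum_pi.
rewrite (@gcompE _ _ _ (span_sum t t') (span_sum s s')
  (tsum T T') (whom_sum u u') (whom_sum v v')) /=; last first.
  by rewrite -2!whom_sum_comp; congr whom_sum.
by rewrite /span_sum /= 2!whom_sum_comp.
Qed.

Lemma gsum_id P Q : gsum (idm P) (idm Q) = idm (tsum P Q : Gcat).
Proof. by rewrite /= gsum_pi /span_sum /= whom_sum_id. Qed.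

Definition gof P Q (f : whom P Q) : hom P Q := frac_of (C := W) f.

Lemma gof_comp P Q R (g : whom Q R) (f : whom P Q) :
  gof (whom_comp g f) = gof g ∘ gof f.
Proof. exact: (@frac_of_comp W (@whom_ore A) (@whom_cancel A) _ _ _ g f). Qed.

Lemma gof_sum P P' Q Q' (f : whom P Q) (g : whom P' Q') :
  gof (whom_sum f g) = gsum (gof f) (gof g).
Proof. by rewrite gsum_pi /span_sum /= whom_sum_id. Qed.

Lemma gof_id P : gof (whom_id P) = idm P.
Proof. by []. Qed.

Definition gassoc P Q R : hom (tsum P (tsum Q R) : Gcat) (tsum (tsum P Q) R) :=
  gof (wassoc P Q R).
Definition grunit P : hom (tsum P (tempty A) : Gcat) P := gof (wrunit P).
Definition glunit P : hom (tsum (tempty A) P : Gcat) P := gof (wlunit P).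

Lemma gof_nat (P P' Q Q' : W) (s : span P Q) (s' : span P' Q')
    (al : hom P P') (be : hom Q Q') (ga : hom (apex s) (apex s')) :
  al ∘ lleg s = lleg s' ∘ ga -> be ∘ rleg s = rleg s' ∘ ga ->
  gof be ∘ (frac_pi s : hom (P : Gcat) Q) =
  (frac_pi s' : hom (P' : Gcat) Q') ∘ gof al.
Proof.
move=> el er.
have e1 : rleg s ∘ idm (apex s) = idm Q ∘ rleg s by rewrite compm1 comp1m.
rewrite (@gcompE _ _ _ (Span (idm Q) be) s _ _ _ e1).
rewrite (@gcompE _ _ _ s' (Span (idm P) al) _ _ _ el).
by congr (frac_pi (Span _ _)); [rewrite compm1 comp1m|exact: er].
Qed.

Lemma gassoc_nat P P' Q Q' R R' (f : hom P P') (g : hom Q Q') (h : hom R R') :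
  gassoc P' Q' R' ∘ gsum f (gsum g h) = gsum (gsum f g) h ∘ gassoc P Q R.
Proof.
have [s ->] := fracP f; have [t ->] := fracP g; have [r ->] := fracP h.
rewrite !gsum_pi; by apply: (@gof_nat _ _ _ _ (span_sum s (span_sum t r))
  (span_sum (span_sum s t) r) (wassoc P Q R) (wassoc P' Q' R') (wassoc _ _ _));
  exact: wassoc_nat.
Qed.

Lemma grunit_nat P Q (f : hom P Q) :
  grunit Q ∘ gsum f (idm (tempty A : Gcat)) = f ∘ grunit P.
Proof.
have [s ->] := fracP f; rewrite gsum_pi.
by apply: (@gof_nat _ _ _ _ (span_sum s (Span (idm _) (idm _))) s (wrunit P)
  (wrunit Q) (wrunit _)); exact: wrunit_nat.
Qed.

Lemma grunit_assoc P Q :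
  grunit (tsum P Q) ∘ gassoc P Q (tempty A) = gsum (idm P) (grunit Q).
Proof. by rewrite -gof_comp wrunit_assoc gof_sum gof_id. Qed.

Lemma gtriangle P Q :
  gsum (grunit P) (idm Q) ∘ gassoc P (tempty A) Q = gsum (idm P) (glunit Q).
Proof. by rewrite -gof_id -gof_sum -gof_comp wtriangle gof_sum. Qed.

Lemma gpentagon P Q R S :
  gassoc (tsum P Q) R S ∘ gassoc P Q (tsum R S) =
  gsum (gassoc P Q R) (idm S) ∘
    (gassoc P (tsum Q R) S ∘ gsum (idm P) (gassoc Q R S)).
Proof. by rewrite -!gof_id -!gof_sum -!gof_comp wpentagon. Qed.

Lemma Gcat_groupoid P Q (f : hom P Q) :
  exists g : hom Q P, g ∘ f = idm P /\ f ∘ g = idm Q.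
Proof. by exists (frac_inv f); split; [exact: (@frac_invK W (@whom_ore A) (@whom_cancel A))|exact: (@frac_homK W (@whom_ore A) (@whom_cancel A))]. Qed.

Record embedding P Q := Embedding {
  complement : Gcat;
  emb_map : hom (tsum P complement : Gcat) Q }.

(* The morphism [s] is an isomorphism, like all those of [Gcat]. *)
Definition embedding_eq P Q (e e' : embedding P Q) : Prop :=
  exists s : hom (complement e) (complement e'),
    emb_map e' ∘ gsum (idm P) s = emb_map e.

Lemma embedding_eq_refl P Q (e : embedding P Q) : embedding_eq e e.
Proof. by exists (idm _); rewrite gsum_id compm1. Qed.

Lemma embedding_eq_sym P Q (e e' : embedding P Q) :
  embedding_eq e e' -> embedding_eq e' e.
Proof.
move=> [s es]; have [t [ts st]] := Gcat_groupoid s; exists t.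
by rewrite -es -compmA -gsum_comp st comp1m gsum_id compm1.
Qed.

Lemma embedding_eq_trans P Q (e1 e2 e3 : embedding P Q) :
  embedding_eq e1 e2 -> embedding_eq e2 e3 -> embedding_eq e1 e3.
Proof.
move=> [s es] [t et]; exists (t ∘ s).
by rewrite -es -et -compmA -gsum_comp comp1m.
Qed.

Definition UGhom P Q := quot (@embedding_eq P Q).

Definition ug_pi P Q (e : embedding P Q) : UGhom P Q :=
  quot_pi (@embedding_eq P Q) e.

Lemma ug_piP P Q (e e' : embedding P Q) : ug_pi e = ug_pi e' <-> embedding_eq e e'.
Proof.
apply: quot_piP; [exact: embedding_eq_refl|exact: embedding_eq_sym|].
exact: embedding_eq_trans.
Qed.

Lemma ug_repr P Q (f : UGhom P Q) : ug_pi (quot_repr f) = f.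
Proof. exact: quot_reprK. Qed.

Lemma ugP P Q (f : UGhom P Q) : exists e, f = ug_pi e.
Proof. by exists (quot_repr f); rewrite ug_repr. Qed.

Definition embedding_id P : embedding P P := Embedding (grunit P).

Definition embedding_comp P Q R (g : embedding Q R) (f : embedding P Q) :
    embedding P R :=
  @Embedding P R (tsum (complement f) (complement g))
    (emb_map g ∘ gsum (emb_map f) (idm (complement g)) ∘
     gassoc P (complement f) (complement g)).

Lemma emb_map_comp P Q R (g : embedding Q R) (f : embedding P Q) :
  emb_map (embedding_comp g f) =
  emb_map g ∘ gsum (emb_map f) (idm (complement g)) ∘
    gassoc P (complement f) (complement g).
Proof. by []. Qed.

Definition ug_id P : UGhom P P := ug_pi (embedding_id P).

Definition ug_comp P Q R (g : UGhom Q R) (f : UGhom P Q) : UGhom P R :=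
  ug_pi (embedding_comp (quot_repr g) (quot_repr f)).

Lemma ug_comp_pi P Q R (g : embedding Q R) (f : embedding P Q) :
  ug_comp (ug_pi g) (ug_pi f) = ug_pi (embedding_comp g f).
Proof.
have /ug_piP[s es] := ug_repr (ug_pi f); have /ug_piP[t et] := ug_repr (ug_pi g).
apply/ug_piP; exists (gsum s t); rewrite !emb_map_comp -es -et.
rewrite -!compmA gassoc_nat !compmA; congr (_ ∘ _).
by rewrite -!compmA -!gsum_comp !comp1m compm1.
Qed.

Fact ug_comp1m P Q (f : UGhom P Q) : ug_comp (ug_id Q) f = f.
Proof.
have [e ->] := ugP f; rewrite ug_comp_pi; apply/ug_piP; exists (grunit (complement e)).
by rewrite emb_map_comp grunit_nat -compmA grunit_assoc.
Qed.

Fact ug_compm1 P Q (f : UGhom P Q) : ug_comp f (ug_id P) = f.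
Proof.
have [e ->] := ugP f; rewrite ug_comp_pi; apply/ug_piP; exists (glunit (complement e)).
by rewrite emb_map_comp -compmA gtriangle.
Qed.

Fact ug_compA P Q R S (h : UGhom R S) (g : UGhom Q R) (f : UGhom P Q) :
  ug_comp h (ug_comp g f) = ug_comp (ug_comp h g) f.
Proof.
have [a ->] := ugP f; have [b ->] := ugP g; have [c ->] := ugP h.
rewrite !ug_comp_pi; symmetry; apply/ug_piP.
exists (gassoc (complement a) (complement b) (complement c)).
rewrite !emb_map_comp.
have gsum_compl P1 P2 P3 P4 (u : hom P2 P3) (v : hom P1 P2) :
    gsum (u ∘ v) (idm P4) = gsum u (idm P4) ∘ gsum v (idm P4).
  by rewrite -gsum_comp comp1m.
rewrite !gsum_compl -!compmA -gpentagon -(gsum_id (complement b)).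
congr (_ ∘ (_ ∘ _)).
by rewrite (compmA (gassoc Q _ _)) (gassoc_nat (emb_map a)) -compmA.
Qed.

Definition UGcat : category := Category ug_comp1m ug_compm1 ug_compA.

End ScissorsCongruence.

Notation "P ≃ Q" := (isomorphic (P : Gcat _) Q) : cat_scope.

Definition S_assembler (A : assembler) : Prop :=
  forall P Q : Gcat A, ~ P ≃ tempty A -> ~ Q ≃ tempty A ->
    exists P' : Gcat A, ~ P' ≃ tempty A /\ tsum P P' ≃ Q.

Section Volume.
Local Open Scope ring_scope.

(* [porderZmodType] does not relate the order to the addition. *)
Definition ordered_group (R : porderZmodType) : Prop :=
  forall x y z : R, x <= y -> x + z <= y + z.

Variables (A : assembler) (R : porderZmodType) (vol : A -> R).

Definition volume_function : Prop :=
  (forall X, 0 <= vol X) /\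
  (forall (X : A) (I : finSet) (P : I -> A) (f : forall i, hom (P i) X),
     is_cover asm_top f -> vol X = \sum_(i : I) vol (P i)).

Definition tvol (P : ftuple A) : R := \sum_(i : idx P) vol (piece P i).

(* A cover of a tuple [Q] by finitely many pieces is a morphism of [Wcat]
   to [Q]. *)
Definition EA_assembler : Prop :=
  [/\ ordered_group R,
      volume_function,
      forall P Q : Gcat A, tvol P < tvol Q ->
        exists P' : Gcat A, tsum P P' ≃ Q
    & forall P : ftuple A, 0 < tvol P ->
        forall Q : ftuple A, exists (S : Wcat A) (f : hom S Q),
          forall i : idx S, vol (piece S i) *+ 2 <= tvol P].

End Volume.

(* Main.v *)
Require Import Defs.
From mathcomp Require Import all_boot order ssralg orderedzmod.
From mathcomp Require Import boolp classical_sets.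

Set Implicit Arguments.
Unset Strict Implicit.
Unset Printing Implicit Defensive.
Import Order.TTheory GRing.Theory.

Local Open Scope cat_scope.

(** Let [G] be the automorphism group of [P]. The claim is that the quotient of
    [G] by its second derived subgroup is abelian, and it suffices to find a
    generating set whose members commute in that quotient.

    Displacement makes small automorphisms commute. If [a] and [b] are
    automorphisms of [Q] and [P] contains three disjoint copies of [Q], then [a]
    acting on the first copy and its inverse acting on the second is the
    commutator of an automorphism with a swap of copies, and so is [b] on the first
    copy with its inverse on the third; the commutator of these two commutators is
    that of [a] and [b], both acting on the first copy ([three_copies_commute]).
    Hence two automorphisms of [P] that fix a common part [C] commute modulo the
    second derived subgroup as soon as [C] has room for two copies of its
    complement ([commute_of_room]).

    When volumes are available, small means supported on a part of volume at most
    that of [B], where [B] has at most an eighth of the volume of [P]: the common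
    refinement of two decompositions of [P] shows that two small automorphisms fix
    a common part of large volume. For an S-assembler, small means to fix a
    nonempty part. Any nonempty part has enough room, but two small automorphisms
    [f] and [g] may fix disjoint parts; then [f] is first conjugated by a swap that
    moves a piece of what [g] fixes into what [f] fixes. That swap and [f] fix a
    common nonempty part, so that the conjugation does not change the class of [f]
    in the quotient ([nonempty_commute]).

    Small automorphisms generate. Given [f] and a part [R] of [P] such that a
    further copy of [R] is disjoint from [R] and from its image under [f], two
    swaps bring the image of [R] back to [R], so that [f] times two swaps fixes [R]
    ([move_back]). For an S-assembler this exhibits [f] as a product of swaps and
    of an automorphism that fixes the nonempty part [R], except when no such
    copy exists for want of space, in which case [f] moves a piece of [R] off [R]
    and one swap is enough ([nonempty_generate]). For an EA-assembler the
    complement of [B] is cut into tiny pieces that are fixed one after the other,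
    the room for the further copy being always found inside the remaining
    part, which contains [B] ([contains_aut_add]).

    Everything is done in the groupoid of scissors congruences; its automorphisms
    of [P] surject onto those of [P] as an object of [UGcat] ([ug_aut_surj]). *)

(** * Commutator subgroups *)

Section CommutatorSubgroups.
Local Open Scope group_scope.
Variable G : groupType.
Implicit Types (H : set G) (x y z : G).

Lemma commutator_subgroup_closed H :
  [/\ commutator_subgroup H 1,
      forall x y, commutator_subgroup H x -> commutator_subgroup H y ->
        commutator_subgroup H (x * y)
    & forall x, commutator_subgroup H x -> commutator_subgroup H x^-1].
Proof.
have clos : group_closed (mem (commutator_subgroup H)).
  split=> [|x y]; rewrite !inE.
    by move=> K [[K1 _] _]; rewrite inE in K1.
  move=> Hx Hy K KP; have [[_ KB] _] := KP.
  by have := KB x y; rewrite !inE; apply; [exact: Hx|exact: Hy].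
have [c1 _] := clos; have cM := group_closedM clos; have cV := group_closedV clos.
split; first by rewrite inE in c1.
- by move=> x y Hx Hy; have := cM x y; rewrite !inE; apply.
by move=> x Hx; have := cV x; rewrite !inE; apply.
Qed.

Lemma commutator_subgroup1 H : commutator_subgroup H 1.
Proof. by have [] := commutator_subgroup_closed H. Qed.

Lemma commutator_subgroupM H x y : commutator_subgroup H x ->
  commutator_subgroup H y -> commutator_subgroup H (x * y).
Proof. by have [_ + _] := commutator_subgroup_closed H; apply. Qed.

Lemma commutator_subgroupV H x :
  commutator_subgroup H x -> commutator_subgroup H x^-1.
Proof. by have [_ _] := commutator_subgroup_closed H; apply. Qed.

Lemma mem_commutator_subgroup H x y : H x -> H y -> commutator_subgroup H [~ x, y].
Proof. by move=> Hx Hy; apply: sub_gen_smallest; exists x => //; exists y. Qed.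

Lemma commutator_subgroup_ind H (N : set G) : N 1 ->
  (forall x y, N x -> N y -> N (x * y)) -> (forall x, N x -> N x^-1) ->
  (forall x y, H x -> H y -> N [~ x, y]) ->
  forall x, commutator_subgroup H x -> N x.
Proof.
move=> N1 NM NV NC; apply: smallest_sub; last by move=> _ [x Hx [y Hy <-]]; exact: NC.
by split=> [|x y]; rewrite !inE // => Nx Ny; apply: NM => //; exact: NV.
Qed.

Lemma commutator_subgroupJ H : (forall g x, H x -> H (x ^ g)) ->
  forall g x, commutator_subgroup H x -> commutator_subgroup H (x ^ g).
Proof.
move=> HJ g; apply: commutator_subgroup_ind.
- by rewrite conj1g; exact: commutator_subgroup1.
- by move=> x y Hx Hy; rewrite conjMg; exact: commutator_subgroupM.
- by move=> x Hx; rewrite conjVg; exact: commutator_subgroupV.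
- by move=> x y Hx Hy; rewrite conjRg; apply: mem_commutator_subgroup; exact: HJ.
Qed.

Definition derived2 : set G := commutator_subgroup (commutator_subgroup [set: G]).

Lemma derived2J g x : derived2 x -> derived2 (x ^ g).
Proof. by apply: commutator_subgroupJ; exact: commutator_subgroupJ. Qed.

Definition commute_mod x y := derived2 [~ x, y].

Lemma commute_mod_sym x y : commute_mod x y -> commute_mod y x.
Proof. by move=> xy; rewrite /commute_mod -invgR; exact: commutator_subgroupV. Qed.

Lemma commute_mod1 x : commute_mod 1 x.
Proof. by rewrite /commute_mod comm1g; exact: commutator_subgroup1. Qed.

Lemma commute_modM x y z :
  commute_mod x z -> commute_mod y z -> commute_mod (x * y) z.
Proof.
move=> xz yz; rewrite /commute_mod.
have -> : [~ x * y, z] = [~ x, z] ^ y * [~ y, z].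
  by rewrite !commgEl !conjgE !invgM !mulgA !mulgK.
by apply: commutator_subgroupM => //; exact: derived2J.
Qed.

Lemma commute_modV x z : commute_mod x z -> commute_mod x^-1 z.
Proof.
move=> xz; rewrite /commute_mod.
suff -> : [~ x^-1, z] = ([~ x, z] ^ x^-1)^-1.
  by apply: commutator_subgroupV; exact: derived2J.
by rewrite !commgEl !conjgE !invgM !invgK !mulgA mulgK.
Qed.

Lemma commute_mod_derived2 x z : derived2 x -> commute_mod x z.
Proof.
move=> Kx; rewrite /commute_mod commgEl.
by apply: commutator_subgroupM; [exact: commutator_subgroupV|exact: derived2J].
Qed.

(** If [x] and [u] commute in the quotient by [derived2], then [x] and
    [u * x * u^-1] have the same image there. *)
Lemma commute_mod_conj u x z :
  commute_mod u x -> commute_mod (u * x * u^-1) z -> commute_mod x z.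
Proof.
move=> ux uxz; have -> : x = (u * x * u^-1) * [~ x^-1, u^-1] ^ x.
  by rewrite !commgEl !conjgE !invgK !mulgA !mulgVK mulgK mulgV mul1g.
apply: commute_modM => //; apply: commute_mod_derived2; apply: derived2J.
apply: (commute_modV (z := u^-1)); apply: commute_mod_sym.
exact: commute_modV.
Qed.

(** Once all commutators lie in the second derived subgroup, so does the subgroup
    that they generate. *)
Lemma quasi_perfect_commute_mod : (forall x y, commute_mod x y) -> quasi_perfect G.
Proof.
move=> Gab; rewrite /quasi_perfect /perfect; apply/seteqP; split.
  apply: commutator_subgroup_ind; first exact: commutator_subgroup1.
  - exact: commutator_subgroupM.
  - exact: commutator_subgroupV.
  - by move=> x y _ _; exact: mem_commutator_subgroup.
apply: commutator_subgroup_ind; first exact: commutator_subgroup1.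
- exact: commutator_subgroupM.
- exact: commutator_subgroupV.
- by move=> x y _ _; exact: Gab.
Qed.

End CommutatorSubgroups.

Reserved Notation "P ⊔ Q" (at level 50, left associativity).
Reserved Notation "f ⊞ g" (at level 50, left associativity).

(** * Symmetries of disjoint unions *)

Section Symmetries.
Variable A : assembler.

Section WSymmetries.
Variables B C D E : ftuple A.

Definition wbraid_map (x : idx (tsum B C)) : idx (tsum C B) :=
  match x with inl i => inr i | inr j => inl j end.

Definition wbraid_arr x : hom (piece (tsum B C) x) (piece (tsum C B) (wbraid_map x)) :=
  match x with inl i => idm (piece B i) | inr j => idm (piece C j) end.

Definition wbraid : whom (tsum B C) (tsum C B).
Proof.
apply: (relabel (f := wbraid_arr)).
- by move=> [i|i] [j|j] //= [->].
- by move=> [i|i]; [exists (inr i)|exists (inl i)].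
- by move=> [i|i]; exists (idm _); rewrite comp1m.
Defined.

Definition wswap_map (x : idx (tsum B (tsum C D))) : idx (tsum C (tsum B D)) :=
  match x with
  | inl i => inr (inl i)
  | inr (inl j) => inl j
  | inr (inr k) => inr (inr k)
  end.

Definition wswap_arr x :
    hom (piece (tsum B (tsum C D)) x) (piece (tsum C (tsum B D)) (wswap_map x)) :=
  match x with
  | inl i => idm (piece B i)
  | inr (inl j) => idm (piece C j)
  | inr (inr k) => idm (piece D k)
  end.

Definition wswap : whom (tsum B (tsum C D)) (tsum C (tsum B D)).
Proof.
apply: (relabel (f := wswap_arr)).
- by move=> [i|[i|i]] [j|[j|j]] //= [->].
- by move=> [i|[i|i]]; [exists (inr (inl i))|exists (inl i)|exists (inr (inr i))].
- by move=> [i|[i|i]]; exists (idm _); rewrite comp1m.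
Defined.

Definition wrot_map (x : idx (tsum B (tsum C D))) : idx (tsum C (tsum D B)) :=
  match x with
  | inl i => inr (inr i)
  | inr (inl j) => inl j
  | inr (inr k) => inr (inl k)
  end.

Definition wrot_arr x :
    hom (piece (tsum B (tsum C D)) x) (piece (tsum C (tsum D B)) (wrot_map x)) :=
  match x with
  | inl i => idm (piece B i)
  | inr (inl j) => idm (piece C j)
  | inr (inr k) => idm (piece D k)
  end.

Definition wrot : whom (tsum B (tsum C D)) (tsum C (tsum D B)).
Proof.
apply: (relabel (f := wrot_arr)).
- by move=> [i|[i|i]] [j|[j|j]] //= [->].
- by move=> [i|[i|i]]; [exists (inr (inl i))|exists (inr (inr i))|exists (inl i)].
- by move=> [i|[i|i]]; exists (idm _); rewrite comp1m.
Defined.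

Definition wmid_map (x : idx (tsum (tsum B C) (tsum D E))) :
    idx (tsum (tsum B D) (tsum C E)) :=
  match x with
  | inl (inl i) => inl (inl i)
  | inl (inr j) => inr (inl j)
  | inr (inl k) => inl (inr k)
  | inr (inr l) => inr (inr l)
  end.

Definition wmid_arr x :
    hom (piece (tsum (tsum B C) (tsum D E)) x)
        (piece (tsum (tsum B D) (tsum C E)) (wmid_map x)) :=
  match x with
  | inl (inl i) => idm (piece B i)
  | inl (inr j) => idm (piece C j)
  | inr (inl k) => idm (piece D k)
  | inr (inr l) => idm (piece E l)
  end.

Definition wmid : whom (tsum (tsum B C) (tsum D E)) (tsum (tsum B D) (tsum C E)).
Proof.
apply: (relabel (f := wmid_arr)).
- by move=> [[i|i]|[i|i]] [[j|j]|[j|j]] //= [->].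
- move=> [[i|i]|[i|i]]; [exists (inl (inl i))|exists (inr (inl i))|
    exists (inl (inr i))|exists (inr (inr i))]; by [].
- by move=> [[i|i]|[i|i]]; exists (idm _); rewrite comp1m.
Defined.

End WSymmetries.

Implicit Types B C D E P Q R S : Gcat A.
Local Notation "P ⊔ Q" := (tsum P Q : Gcat A).
Local Notation "f ⊞ g" := (gsum f g).

Definition gbraid B C : hom (B ⊔ C) (C ⊔ B) := gof (wbraid B C).
Definition gswap B C D : hom (B ⊔ (C ⊔ D)) (C ⊔ (B ⊔ D)) := gof (wswap B C D).
Definition grot B C D : hom (B ⊔ (C ⊔ D)) (C ⊔ (D ⊔ B)) := gof (wrot B C D).
Definition gmid B C D E : hom ((B ⊔ C) ⊔ (D ⊔ E)) ((B ⊔ D) ⊔ (C ⊔ E)) :=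
  gof (wmid B C D E).

Lemma gbraid_nat B B' C C' (f : hom B B') (g : hom C C') :
  gbraid B' C' ∘ (f ⊞ g) = (g ⊞ f) ∘ gbraid B C.
Proof.
have [s ->] := fracP f; have [t ->] := fracP g; rewrite !gsum_pi.
by apply: (@gof_nat _ _ _ _ _ (span_sum s t) (span_sum t s) (wbraid B C)
  (wbraid B' C') (wbraid _ _)); apply: whom_ext => -[i|i] /=; rewrite comp1m compm1.
Qed.

Lemma gswap_nat B B' C C' D D' (f : hom B B') (g : hom C C') (h : hom D D') :
  gswap B' C' D' ∘ (f ⊞ (g ⊞ h)) = (g ⊞ (f ⊞ h)) ∘ gswap B C D.
Proof.
have [s ->] := fracP f; have [t ->] := fracP g; have [r ->] := fracP h.
rewrite !gsum_pi.
by apply: (@gof_nat _ _ _ _ _ (span_sum s (span_sum t r)) (span_sum t (span_sum s r))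
  (wswap B C D) (wswap B' C' D') (wswap _ _ _));
  apply: whom_ext => -[i|[i|i]] /=; rewrite comp1m compm1.
Qed.

Lemma gmid_nat B B' C C' D D' E E' (f : hom B B') (g : hom C C') (h : hom D D')
    (k : hom E E') :
  gmid B' C' D' E' ∘ ((f ⊞ g) ⊞ (h ⊞ k)) = ((f ⊞ h) ⊞ (g ⊞ k)) ∘ gmid B C D E.
Proof.
have [s ->] := fracP f; have [t ->] := fracP g.
have [r ->] := fracP h; have [u ->] := fracP k.
rewrite !gsum_pi.
by apply: (@gof_nat _ _ _ _ _ (span_sum (span_sum s t) (span_sum r u))
  (span_sum (span_sum s r) (span_sum t u)) (wmid B C D E) (wmid B' C' D' E')
  (wmid _ _ _ _)); apply: whom_ext => -[[i|i]|[i|i]] /=; rewrite comp1m compm1.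
Qed.

End Symmetries.

(** * Coherence equations *)

(** Two composites of sums of structural morphisms are equal as soon as the
    underlying maps of indices agree. Three rounds of folding suffice for the
    nesting depth of the sums below. *)
Ltac coherence :=
  rewrite -?gof_id; do 3 rewrite -?gof_sum -?gof_comp; congr gof;
  apply: whom_ext;
  repeat (let x := fresh "x" in move=> x; case: x); move=> * /=; rewrite ?comp1m //.

Section Coherence.
Variable A : assembler.
Implicit Types B C D E P Q R S U V W X Y Z : Gcat A.
Local Notation "P ⊔ Q" := (tsum P Q : Gcat A).
Local Notation "f ⊞ g" := (gsum f g).

(** In the next lemmas both sides carry every summand to the same place. Most of
    them say in two ways how one summand is brought to the front, where it is
    seen as an embedding: two embeddings of a summand that differ by a morphism
    of the remaining summands are identified. *)
Lemma gmid_gswap_front R U V W X :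
  gmid U V W (R ⊔ X) ∘ ((idm (U ⊔ V) ⊞ gswap R W X) ∘ gswap R (U ⊔ V) (W ⊔ X)) =
  (idm (U ⊔ W) ⊞ gswap R V X) ∘ (gswap R (U ⊔ W) (V ⊔ X) ∘ (idm R ⊞ gmid U V W X)).
Proof. coherence. Qed.

Lemma gmid_gassoc U V W Z :
  gmid U V W Z ∘ gassoc U V (W ⊔ Z) = gassoc U W (V ⊔ Z) ∘ (idm U ⊞ gswap V W Z).
Proof. coherence. Qed.

Lemma gmid_second_front U V W Z :
  gmid U V W Z ∘ (gassoc U V (W ⊔ Z) ∘ gswap V U (W ⊔ Z)) =
  gswap V (U ⊔ W) Z ∘ (idm V ⊞ gassoc U W Z).
Proof. coherence. Qed.

Lemma gswap_second_copy_right U V Z :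
  gassoc U V (V ⊔ Z) ∘ (gswap V U (V ⊔ Z) ∘ ((idm V ⊞ gswap V U Z) ∘ gswap V V (U ⊔ Z))) =
  gswap V (U ⊔ V) Z ∘ (idm V ⊞ (gassoc U V Z ∘ gswap V U Z)).
Proof. coherence. Qed.

Lemma gswap_second_copy W X Z :
  gassoc W X (W ⊔ Z) ∘ ((idm W ⊞ gswap W X Z) ∘ gswap W W (X ⊔ Z)) =
  gswap W (W ⊔ X) Z ∘ (idm W ⊞ gassoc W X Z).
Proof. coherence. Qed.

Lemma gmid_third_front U V W Z :
  gmid U V W Z ∘ (gswap W (U ⊔ V) Z ∘ (idm W ⊞ gassoc U V Z)) =
  (gbraid W U ⊞ idm (V ⊔ Z)) ∘ gassoc W U (V ⊔ Z).
Proof. coherence. Qed.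

Lemma gassoc_grot_front W X Z :
  gassoc W X (W ⊔ Z) ∘ ((idm W ⊞ gswap W X Z) ∘ (grot (X ⊔ Z) W W ∘ gassoc X Z (W ⊔ W))) =
  (gbraid X W ⊞ idm (W ⊔ Z)) ∘ (gassoc X W (W ⊔ Z) ∘ (idm X ⊞ grot Z W W)).
Proof. coherence. Qed.

Lemma gswap_sum B C Y :
  exists d : hom (B ⊔ (B ⊔ (C ⊔ (C ⊔ Y)))) ((B ⊔ C) ⊔ ((B ⊔ C) ⊔ Y)),
    gswap (B ⊔ C) (B ⊔ C) Y ∘ d =
    d ∘ (gswap B B (C ⊔ (C ⊔ Y)) ∘ (idm B ⊞ (idm B ⊞ gswap C C Y))).
Proof.
exists (gassoc B C ((B ⊔ C) ⊔ Y) ∘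
  (idm B ⊞ ((idm C ⊞ gassoc B C Y) ∘ gswap B C (C ⊔ Y)))).
coherence.
Qed.

End Coherence.

(** * Embeddings and the automorphisms that fix them *)

Section Groupoid.
Variable A : assembler.
Implicit Types B C D E P Q R S W Y Z : Gcat A.
Local Notation "P ⊔ Q" := (tsum P Q : Gcat A).
Local Notation "f ⊞ g" := (gsum f g).

Definition ginv P Q (f : hom P Q) : hom Q P := frac_inv f.

Lemma gVf P Q (f : hom P Q) : ginv f ∘ f = idm P.
Proof. exact: (@frac_invK (Wcat A) (@whom_ore A) (@whom_cancel A)). Qed.

Lemma gfV P Q (f : hom P Q) : f ∘ ginv f = idm Q.
Proof. exact: (@frac_homK (Wcat A) (@whom_ore A) (@whom_cancel A)). Qed.

Lemma gVfA P Q R (f : hom P Q) (g : hom R P) : ginv f ∘ (f ∘ g) = g.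
Proof. by rewrite compmA gVf comp1m. Qed.

Lemma gfVA P Q R (f : hom P Q) (g : hom R Q) : f ∘ (ginv f ∘ g) = g.
Proof. by rewrite compmA gfV comp1m. Qed.

Lemma ginv_eq P Q (f : hom P Q) (g : hom Q P) : g ∘ f = idm P -> ginv f = g.
Proof. by move=> gf; rewrite -[ginv f]comp1m -gf -compmA gfV compm1. Qed.

Lemma ginvK P Q (f : hom P Q) : ginv (ginv f) = f.
Proof. by apply: ginv_eq; rewrite gfV. Qed.

Lemma ginv1 P : ginv (idm P) = idm P.
Proof. by apply: ginv_eq; rewrite comp1m. Qed.

Lemma ginvM P Q R (f : hom Q R) (g : hom P Q) : ginv (f ∘ g) = ginv g ∘ ginv f.
Proof. by apply: ginv_eq; rewrite -compmA gVfA gVf. Qed.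

Lemma gsumA P Q R P' Q' R' S (f : hom Q R) (g : hom P Q) (f' : hom Q' R')
    (g' : hom P' Q') (x : hom S (P ⊔ P')) :
  (f ⊞ f') ∘ ((g ⊞ g') ∘ x) = ((f ∘ g) ⊞ (f' ∘ g')) ∘ x.
Proof. by rewrite compmA -gsum_comp. Qed.

Lemma ginv_sum P Q P' Q' (f : hom P Q) (f' : hom P' Q') :
  ginv (f ⊞ f') = ginv f ⊞ ginv f'.
Proof. by apply: ginv_eq; rewrite -gsum_comp !gVf gsum_id. Qed.

Lemma isoP P Q : P ≃ Q <-> exists f : hom P Q, True.
Proof.
by split=> [[f _]|[f _]]; [exists f|exists f, (ginv f); rewrite gVf gfV].
Qed.

Lemma iso_sym P Q : P ≃ Q -> Q ≃ P.
Proof. by move=> /isoP[f _]; apply/isoP; exists (ginv f). Qed.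

Lemma iso_trans P Q R : P ≃ Q -> Q ≃ R -> P ≃ R.
Proof. by move=> /isoP[f _] /isoP[g _]; apply/isoP; exists (g ∘ f). Qed.

Lemma iso_sum P P' Q Q' : P ≃ Q -> P' ≃ Q' -> P ⊔ P' ≃ Q ⊔ Q'.
Proof. by move=> /isoP[f _] /isoP[g _]; apply/isoP; exists (f ⊞ g). Qed.

(** Embeddings are compared as morphisms of [UGcat]: this forgets the way in which
    the complement [Q] is parametrized. *)
Definition emb P C Q (e : hom (C ⊔ Q) P) : UGhom C P := ug_pi (Embedding e).

Lemma embP P C Q Q' (e : hom (C ⊔ Q) P) (e' : hom (C ⊔ Q') P) :
  emb e = emb e' <-> exists s : hom Q Q', e' ∘ (idm C ⊞ s) = e.
Proof. exact: ug_piP. Qed.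

Lemma emb_pre P C Q Q' (e : hom (C ⊔ Q) P) (s : hom Q' Q) :
  emb (e ∘ (idm C ⊞ s)) = emb e.
Proof. by apply/embP; exists s. Qed.

Lemma emb_post P P' C Q Q' (u : hom P P') (e : hom (C ⊔ Q) P) (e' : hom (C ⊔ Q') P) :
  emb e = emb e' -> emb (u ∘ e) = emb (u ∘ e').
Proof. by move=> /embP[s es]; apply/embP; exists s; rewrite -compmA es. Qed.

Lemma emb_assoc P C C' Q Q' (e : hom ((C ⊔ C') ⊔ Q) P) (e' : hom ((C ⊔ C') ⊔ Q') P) :
  emb e = emb e' -> emb (e ∘ gassoc C C' Q) = emb (e' ∘ gassoc C C' Q').
Proof.
move=> /embP[s <-]; apply/embP; exists (idm C' ⊞ s).
by rewrite -!compmA gassoc_nat gsum_id.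
Qed.

(** To fix the part [C] is to act on its complement alone, see [fixesP]. *)
Definition fixes P C Q (e : hom (C ⊔ Q) P) (f : hom P P) : Prop := emb (f ∘ e) = emb e.

Lemma fixesP P C Q (e : hom (C ⊔ Q) P) (f : hom P P) :
  fixes e f <-> exists s : hom Q Q, f ∘ e = e ∘ (idm C ⊞ s).
Proof. by split=> [/embP[s]|[s fe]]; [exists s|apply/embP; exists s]. Qed.

Lemma fixes_emb P C Q Q' (e : hom (C ⊔ Q) P) (e' : hom (C ⊔ Q') P) f :
  emb e = emb e' -> fixes e f -> fixes e' f.
Proof. by move=> ee'; rewrite /fixes -(emb_post f ee') -ee'. Qed.

Lemma fixes_pre P C Q C' Q' (e : hom (C ⊔ Q) P) (c : hom C' C) (q : hom Q' Q) f :
  fixes e f -> fixes (e ∘ (c ⊞ q)) f.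
Proof.
move=> /fixesP[s fe]; apply/fixesP; exists (ginv q ∘ (s ∘ q)).
by rewrite compmA fe -!compmA -!gsum_comp gfVA comp1m compm1.
Qed.

Lemma fixes_assoc P C C' Q (e : hom ((C ⊔ C') ⊔ Q) P) f :
  fixes e f -> fixes (e ∘ gassoc C C' Q) f.
Proof. by rewrite /fixes => fe; rewrite compmA; exact: emb_assoc. Qed.

Lemma fixes_conj P P' C Q (e : hom (C ⊔ Q) P) (u : hom P P') f :
  fixes e f -> fixes (u ∘ e) (u ∘ f ∘ ginv u).
Proof. by move=> fe; rewrite /fixes -!compmA gVfA; exact: emb_post. Qed.

Lemma gswapK B C D : gswap C B D ∘ gswap B C D = idm (B ⊔ (C ⊔ D)).
Proof. coherence. Qed.

Definition swap_along P R Y (a : hom (R ⊔ (R ⊔ Y)) P) : hom P P :=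
  a ∘ gswap R R Y ∘ ginv a.

Lemma swap_alongE P R Y (a : hom (R ⊔ (R ⊔ Y)) P) :
  swap_along a ∘ a = a ∘ gswap R R Y.
Proof. by rewrite -!compmA gVf compm1. Qed.

Lemma swap_along_emb P R Y Q (a : hom (R ⊔ (R ⊔ Y)) P) (e : hom (R ⊔ Q) P) :
  emb e = emb (a ∘ gswap R R Y) -> emb (swap_along a ∘ e) = emb a.
Proof.
by move=> /(emb_post (swap_along a)) ->; rewrite compmA swap_alongE -compmA gswapK compm1.
Qed.

Lemma swap_along_emb' P R Y Q (a : hom (R ⊔ (R ⊔ Y)) P) (e : hom (R ⊔ Q) P) :
  emb e = emb a -> emb (swap_along a ∘ e) = emb (a ∘ gswap R R Y).
Proof. by move=> /(emb_post (swap_along a)) ->; rewrite swap_alongE. Qed.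

(** The swap acts on the two copies of [R] only. [grot] brings the fixed summand
    [Y] to the front. *)
Lemma swap_along_fixes P R Y (a : hom (R ⊔ (R ⊔ Y)) P) :
  fixes (a ∘ grot Y R R) (swap_along a).
Proof.
apply/fixesP; exists (gbraid R R).
by rewrite compmA swap_alongE -!compmA; congr (_ ∘ _); coherence.
Qed.

(** For the embedding of [W], the reparametrization [c] only affects the
    complement. *)
Lemma emb_second P B C Q W Z (e : hom (C ⊔ Q) P) (c : hom B C) (q : hom (W ⊔ Z) Q) :
  emb (e ∘ (c ⊞ q) ∘ gswap W B Z) = emb (e ∘ (idm C ⊞ q) ∘ gswap W C Z).
Proof.
rewrite -[RHS](emb_pre _ (c ⊞ idm Z)) -!compmA gswap_nat gsum_id gsumA.
by rewrite comp1m compm1.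
Qed.

End Groupoid.

(** * Empty tuples *)

Section Empty.
Variable A : assembler.
Implicit Types P Q : Gcat A.
Local Notation "P ⊔ Q" := (tsum P Q : Gcat A).
Local Notation "∅" := (tempty A : Gcat A).

(** The apex of a span to the empty tuple is itself empty, hence the empty family
    covers every piece of [P]. *)
Lemma iso_empty_summand P Q : P ⊔ Q ≃ ∅ -> P ≃ ∅.
Proof.
move=> /isoP[f _]; have [[T l r] _] := fracP f.
have cov (i : idx P) : is_cover asm_top
    (fiber_arrow (phi := fun v : idx (tempty A) => match v with end)
      (fun v : idx (tempty A) => match v with end) (P := piece (tempty A)) (Q := piece P) (j := i)).
  move: i; apply/fiber_coverP; split=> i; last by case.
  apply: (@top_sub A (piece P i) _ _ (whom_top l (inl i))); first exact: arrow_sieve_sieve.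
  by move=> Y g [t _]; case: (wmap r t).
apply: iso_sym; apply/isoP; exists (gof (WHom cov : whom (tempty A) P)); by [].
Qed.

Lemma iso_empty_sum P Q : P ≃ ∅ -> Q ≃ ∅ -> P ⊔ Q ≃ ∅.
Proof.
move=> P0 Q0; apply: (iso_trans (iso_sum P0 Q0)).
by apply/isoP; exists (grunit ∅).
Qed.

Lemma iso_empty_left P Q : P ≃ ∅ -> P ⊔ Q ≃ Q.
Proof.
move=> P0; have QQ : Q ≃ Q by apply/isoP; exists (idm Q).
apply: (iso_trans (iso_sum P0 QQ)).
by apply/isoP; exists (glunit Q).
Qed.

End Empty.

(** * Common refinement of two decompositions *)

Section Refinement.
Variable A : assembler.

Definition is_inl (X Y : Type) (s : X + Y) : bool :=
  match s with inl _ => true | inr _ => false end.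

Section Unsum.
Variables (X Y B C : ftuple A) (m : whom (tsum X Y) (tsum B C)).
Hypothesis mX : forall x, is_inl (wmap m (inl x)).
Hypothesis mY : forall y, ~~ is_inl (wmap m (inr y)).

Lemma unsum_left x : {s : {i & hom (piece X x) (piece B i)} |
  existT (fun k => hom (piece X x) (piece (tsum B C) k)) (wmap m (inl x)) (warr m (inl x))
  = existT _ (inl (tag s)) (tagged s)}.
Proof.
have := mX x; move: (warr m (inl x)); case: (wmap m (inl x)) => //= i a _.
by exists (existT _ i a).
Qed.

Lemma unsum_right y : {s : {i & hom (piece Y y) (piece C i)} |
  existT (fun k => hom (piece Y y) (piece (tsum B C) k)) (wmap m (inr y)) (warr m (inr y))
  = existT _ (inr (tag s)) (tagged s)}.
Proof.
have := mY y; move: (warr m (inr y)); case: (wmap m (inr y)) => //= i a _.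
by exists (existT _ i a).
Qed.

Let bx x := sval (unsum_left x).
Let cy y := sval (unsum_right y).

Lemma unsum_left_at x i (a : hom (piece X x) (piece B i)) :
  arrow_at (phi := fun x => tag (bx x)) (fun x => tagged (bx x)) a <->
  arrow_at (P := piece (tsum X Y)) (Q := piece (tsum B C)) (warr m)
    (i := inl x) (j := inl i) a.
Proof.
rewrite /arrow_at /bx; case: unsum_left => -[j b] /= ->; split; last first.
  pose prj (s : {k & hom (piece X x) (piece (tsum B C) k)}) :
      {j & hom (piece X x) (piece B j)} :=
    match s with
    | existT (inl j) a => existT _ j a
    | existT (inr _) _ => existT _ j b
    end.
  by move/(congr1 prj).
by move=> /(congr1 (fun s : {j & hom (piece X x) (piece B j)} =>
  existT (fun k => hom (piece X x) (piece (tsum B C) k)) (inl (tag s)) (tagged s))).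
Qed.

Lemma unsum_right_at y i (a : hom (piece Y y) (piece C i)) :
  arrow_at (phi := fun y => tag (cy y)) (fun y => tagged (cy y)) a <->
  arrow_at (P := piece (tsum X Y)) (Q := piece (tsum B C)) (warr m)
    (i := inr y) (j := inr i) a.
Proof.
rewrite /arrow_at /cy; case: unsum_right => -[j b] /= ->; split; last first.
  pose prj (s : {k & hom (piece Y y) (piece (tsum B C) k)}) :
      {j & hom (piece Y y) (piece C j)} :=
    match s with
    | existT (inr j) a => existT _ j a
    | existT (inl _) _ => existT _ j b
    end.
  by move/(congr1 prj).
by move=> /(congr1 (fun s : {j & hom (piece Y y) (piece C j)} =>
  existT (fun k => hom (piece Y y) (piece (tsum B C) k)) (inr (tag s)) (tagged s))).
Qed.

Lemma unsum_left_cover i : is_cover asm_top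
  (fiber_arrow (phi := fun x => tag (bx x)) (fun x => tagged (bx x)) (j := i)).
Proof.
move: i; apply/fiber_coverP; split=> i.
  apply: (top_sub (whom_top m (inl i))); first exact: arrow_sieve_sieve.
  move=> Z g [[x|y] [a [h [ma ->]]]].
    by exists x, a, h; split=> //; apply/unsum_left_at.
  by have := mY y; rewrite (congr1 tag ma : wmap m (inr y) = inl i).
move=> x x' a a' /unsum_left_at ma /unsum_left_at ma' xx'.
by apply: (whom_disjoint ma ma') => -[].
Qed.

Lemma unsum_right_cover i : is_cover asm_top
  (fiber_arrow (phi := fun y => tag (cy y)) (fun y => tagged (cy y)) (j := i)).
Proof.
move: i; apply/fiber_coverP; split=> i.
  apply: (top_sub (whom_top m (inr i))); first exact: arrow_sieve_sieve.
  move=> Z g [[x|y] [a [h [ma ->]]]].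
    by have := mX x; rewrite (congr1 tag ma : wmap m (inl x) = inr i).
  by exists y, a, h; split=> //; apply/unsum_right_at.
move=> x x' a a' /unsum_right_at ma /unsum_right_at ma' xx'.
by apply: (whom_disjoint ma ma') => -[].
Qed.

(** A morphism that respects the summands is a sum. The casts of [fiber_arrow] are
    avoided by reasoning on [arrow_at], as in the converse statement that a sum of
    morphisms is a morphism. *)
Lemma unsum : exists (b : whom X B) (c : whom Y C), m = whom_sum b c.
Proof.
exists (WHom unsum_left_cover), (WHom unsum_right_cover).
apply: whom_ext => -[x|y] /=.
  by rewrite /bx; case: unsum_left => -[j b] /= ->.
by rewrite /cy; case: unsum_right => -[j b] /= ->.
Qed.

End Unsum.

Definition subtuple (T : ftuple A) (p : pred (idx T)) : ftuple A :=
  @FTuple A (finSet_sub p) (fun x => piece T (val x)).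

Section FourBlocks.
Variables (T : ftuple A) (p q : pred (idx T)).

Let U := subtuple (fun t => p t && q t).
Let V := subtuple (fun t => p t && ~~ q t).
Let W := subtuple (fun t => ~~ p t && q t).
Let Z := subtuple (fun t => ~~ p t && ~~ q t).

Definition blocks_map (x : idx (tsum (tsum U V) (tsum W Z))) : idx T :=
  match x with
  | inl (inl x) => val x
  | inl (inr x) => val x
  | inr (inl x) => val x
  | inr (inr x) => val x
  end.

Definition blocks_arr x :
    hom (piece (tsum (tsum U V) (tsum W Z)) x) (piece T (blocks_map x)) :=
  match x with
  | inl (inl x) => idm (piece U x)
  | inl (inr x) => idm (piece V x)
  | inr (inl x) => idm (piece W x)
  | inr (inr x) => idm (piece Z x)
  end.

Definition blocks : whom (tsum (tsum U V) (tsum W Z)) T.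
Proof.
apply: (relabel (f := blocks_arr)).
- case=> [[[x px]|[x px]]|[[x px]|[x px]]] [[[y py]|[y py]]|[[y py]|[y py]]] /= xy;
    subst y; try (by rewrite (bool_irrelevance px py));
    exfalso; move: px py; case: (p x); case: (q x) => //=.
- move=> t; case pt: (p t); case qt: (q t).
  + have h : p t && q t by rewrite pt qt.
    by exists (inl (inl (exist _ t h))).
  + have h : p t && ~~ q t by rewrite pt qt.
    by exists (inl (inr (exist _ t h))).
  + have h : ~~ p t && q t by rewrite pt qt.
    by exists (inr (inl (exist _ t h))).
  + have h : ~~ p t && ~~ q t by rewrite pt qt.
    by exists (inr (inr (exist _ t h))).
- by move=> [[x|x]|[x|x]]; exists (idm _); rewrite comp1m.
Defined.

End FourBlocks.

Local Notation "P ⊔ Q" := (tsum P Q : Gcat A).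
Local Notation "f ⊞ g" := (gsum f g).

(** Cut the apex of a span that represents [ginv e2 ∘ e1] according to the summands
    in which its two legs land: [U], [V], [W] and [Z] are the intersections of [C1]
    with [C2], of [C1] with [Q2], of [Q1] with [C2], and of [Q1] with [Q2]. *)
Lemma common_refinement (P C1 Q1 C2 Q2 : Gcat A)
    (e1 : hom (C1 ⊔ Q1) P) (e2 : hom (C2 ⊔ Q2) P) :
  exists (U V W Z : Gcat A) (c1 : hom (U ⊔ V) C1) (q1 : hom (W ⊔ Z) Q1)
      (c2 : hom (U ⊔ W) C2) (q2 : hom (V ⊔ Z) Q2),
    e1 ∘ (c1 ⊞ q1) = e2 ∘ (c2 ⊞ q2) ∘ gmid U V W Z.
Proof.
have [[T l r] els] := fracP (ginv e2 ∘ e1).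
pose p t := is_inl (wmap l t); pose q t := is_inl (wmap r t).
pose J := blocks p q.
pose J' := whom_comp J (wmid _ _ _ _) : whom (tsum
  (tsum (subtuple (fun t => p t && q t)) (subtuple (fun t => ~~ p t && q t)))
  (tsum (subtuple (fun t => p t && ~~ q t)) (subtuple (fun t => ~~ p t && ~~ q t)))) T.
have [c1 [q1 el]] : exists b c, whom_comp l J = whom_sum b c.
  by apply: unsum => [[[x /= /andP[px qx]]|[x /= /andP[px qx]]]|
    [[x /= /andP[px qx]]|[x /= /andP[px qx]]]].
have [c2 [q2 er]] : exists b c, whom_comp r J' = whom_sum b c.
  by apply: unsum => [[[x /= /andP[px qx]]|[x /= /andP[px qx]]]|
    [[x /= /andP[px qx]]|[x /= /andP[px qx]]]].
exists (subtuple (fun t => p t && q t)), (subtuple (fun t => p t && ~~ q t)),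
  (subtuple (fun t => ~~ p t && q t)), (subtuple (fun t => ~~ p t && ~~ q t)),
  (gof c1), (gof q1), (gof c2), (gof q2).
rewrite -!gof_sum -el -er !gof_comp.
have e1E : e1 = e2 ∘ (gof r ∘ ginv (gof l)).
  rewrite -[LHS](gfVA e2); congr (_ ∘ _); rewrite [LHS]els.
  exact: (@frac_piE (Wcat A) (@whom_ore A) (@whom_cancel A)).
rewrite e1E -!compmA gVfA; congr (_ ∘ (_ ∘ _)).
rewrite /gmid -!gof_comp; congr gof; apply: whom_ext => -[[x|x]|[x|x]] /=;
  by rewrite !comp1m.
Qed.

End Refinement.

(** * Commutators of automorphisms with room to move *)

Section Displacement.
Variable A : assembler.
Implicit Types B C D E P Q R S U V W X Y Z : Gcat A.
Local Notation "P ⊔ Q" := (tsum P Q : Gcat A).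
Local Notation "f ⊞ g" := (gsum f g).

Definition gcomm P (u v : hom P P) : hom P P := ginv u ∘ (ginv v ∘ (u ∘ v)).

Lemma gcomm_sum P Q (u v : hom P P) (u' v' : hom Q Q) :
  gcomm (u ⊞ u') (v ⊞ v') = gcomm u v ⊞ gcomm u' v'.
Proof. by rewrite /gcomm !ginv_sum -!gsum_comp. Qed.

Lemma gcomm1g P (u : hom P P) : gcomm (idm P) u = idm P.
Proof. by rewrite /gcomm ginv1 !comp1m gVf. Qed.

Lemma gcommg1 P (u : hom P P) : gcomm u (idm P) = idm P.
Proof. by rewrite /gcomm ginv1 compm1 comp1m gVf. Qed.

(** Used when [t] is a swap, so that [y] is [x] acting on another copy. *)
Lemma gcomm_intertwine P (x y t : hom P P) : x ∘ t = t ∘ y -> gcomm x t = ginv x ∘ y.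
Proof. by rewrite /gcomm => ->; rewrite gVfA. Qed.

(** Stating commutation through such a [psi] lets one transport it along an
    isomorphism [Q -> P] by conjugating [psi], with the same target group. *)
Definition composition_morphism (G : groupType) P (psi : hom P P -> G) : Prop :=
  forall f g, psi (f ∘ g) = (psi f * psi g)%g.

Section CompositionMorphism.
Variables (G : groupType) (P : Gcat A) (psi : hom P P -> G).
Hypothesis psiM : composition_morphism psi.

Lemma composition_morphism1 : psi (idm P) = 1%g.
Proof. by apply: (mulgI (psi (idm P))); rewrite -psiM comp1m mulg1. Qed.

Lemma composition_morphismV f : psi (ginv f) = ((psi f)^-1)%g.
Proof. by apply: (mulgI (psi f)); rewrite -psiM gfV composition_morphism1 mulgV. Qed.

Lemma composition_morphismR f g : psi (gcomm f g) = [~ psi f, psi g]%g.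
Proof. by rewrite /gcomm !psiM !composition_morphismV. Qed.

End CompositionMorphism.

Section ThreeCopies.
Variables (G : groupType) (Q Y : Gcat A).
Variable psi : hom (Q ⊔ (Q ⊔ (Q ⊔ Y))) (Q ⊔ (Q ⊔ (Q ⊔ Y))) -> G.
Hypothesis psiM : composition_morphism psi.

Let first (a : hom Q Q) := a ⊞ idm (Q ⊔ (Q ⊔ Y)).

(** With [a] and its inverse on the first two copies, and [b] and its inverse on the
    first and third, only the first copy sees both: the commutator of the
    two is that of [a] and [b] there. Each of them is a commutator with a swap
    of copies. *)
Lemma three_copies_commute (a b : hom Q Q) :
  commute_mod (psi (first a)) (psi (first b)).
Proof.
pose t12 := gswap Q Q (Q ⊔ Y).
pose t23 := idm Q ⊞ gswap Q Q Y.
pose t13 := t23 ∘ (t12 ∘ t23).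
have e23 x : first x ∘ t23 = t23 ∘ first x.
  by rewrite /first /t23 -!gsum_comp !comp1m !compm1.
have e12 x : first x ∘ t12 = t12 ∘ (idm Q ⊞ (x ⊞ idm (Q ⊔ Y))).
  by rewrite /t12 gswap_nat gsum_id.
have e13 x : first x ∘ t13 = t13 ∘ (idm Q ⊞ (idm Q ⊞ (x ⊞ idm Y))).
  rewrite /t13 compmA e23 -compmA (compmA (first x)) e12 -!compmA.
  congr (_ ∘ (_ ∘ _)); rewrite /t23 -!gsum_comp -(gsum_id Q Y).
  by rewrite gswap_nat.
have -> : commute_mod (psi (first a)) (psi (first b)) =
    derived2 [~ psi (gcomm (first (ginv a)) t12), psi (gcomm (first (ginv b)) t13)]%g.
  rewrite (gcomm_intertwine (e12 _)) (gcomm_intertwine (e13 _)).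
  rewrite /commute_mod -!(composition_morphismR psiM); congr (derived2 (psi _)).
  rewrite /first !ginv_sum !ginvK !ginv1 -!gsum_comp !compm1 !comp1m.
  by rewrite -!(gsum_id Q) !gcomm_sum !gcomm1g !gcommg1.
apply: mem_commutator_subgroup; rewrite (composition_morphismR psiM);
  exact: mem_commutator_subgroup.
Qed.

End ThreeCopies.

(** Two automorphisms that act on [Q] alone, with two further copies of [Q] in [C],
    are an instance of [three_copies_commute] after transport along [e]. *)
Lemma commute_of_room (G : groupType) P (psi : hom P P -> G) C Q Y
    (e : hom (C ⊔ Q) P) (f g : hom P P) : composition_morphism psi ->
  fixes e f -> fixes e g -> Q ⊔ (Q ⊔ Y) ≃ C -> commute_mod (psi f) (psi g).
Proof.
move=> psiM /fixesP[s fe] /fixesP[t ge] /isoP[c _].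
have [e' e'E] : exists e', e' = e ∘ ((c ⊞ idm Q) ∘ gbraid Q (Q ⊔ (Q ⊔ Y))).
  by eexists.
have psi'M : composition_morphism (fun x => psi (e' ∘ x ∘ ginv e')).
  by move=> x y; rewrite -psiM -!compmA gVfA.
have conjE h u : h ∘ e = e ∘ (idm C ⊞ u) ->
    h = e' ∘ (u ⊞ idm (Q ⊔ (Q ⊔ Y))) ∘ ginv e'.
  move=> he; have he' : h ∘ e' = e' ∘ (u ⊞ idm (Q ⊔ (Q ⊔ Y))).
    rewrite e'E compmA he -!compmA gbraid_nat !gsumA.
    by rewrite !comp1m !compm1.
  by rewrite -he' -compmA gfV compm1.
by rewrite (conjE f s fe) (conjE g t ge); exact: (three_copies_commute psi'M).
Qed.

Definition is_subgroup P (N : hom P P -> Prop) : Prop :=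
  [/\ N (idm P), forall f g, N f -> N g -> N (f ∘ g) & forall f, N f -> N (ginv f)].

Lemma subgroup_cancel P (N : hom P P -> Prop) f g :
  is_subgroup N -> N f -> N (f ∘ g) -> N g.
Proof.
by move=> [_ NM NV] Nf Nfg; rewrite -(gVfA f g); apply: NM => //; exact: NV.
Qed.

(** Centralizers modulo the second derived subgroup are subgroups, so commutation
    passes from generators to all elements, in one argument and then in the
    other. *)
Lemma quasi_perfect_of_generation (G : groupType) P (psi : hom P P -> G)
    (small : hom P P -> Prop) :
  composition_morphism psi -> (forall x, exists f, psi f = x) ->
  (forall N, is_subgroup N -> (forall f, small f -> N f) -> forall f, N f) ->
  (forall f g, small f -> small g -> commute_mod (psi f) (psi g)) ->
  quasi_perfect G.
Proof.
move=> psiM psi_surj gen small_comm.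
have centralizer y : is_subgroup (fun f => commute_mod (psi f) y).
  split=> [|f g fy gy|f fy]; first by rewrite (composition_morphism1 psiM); exact: commute_mod1.
    by rewrite psiM; exact: commute_modM.
  by rewrite (composition_morphismV psiM); exact: commute_modV.
apply: quasi_perfect_commute_mod => x y.
have [f <-] := psi_surj x; have [g <-] := psi_surj y.
move: f; apply: (gen _ (centralizer _)) => f sf; apply: commute_mod_sym; move: g.
by apply: (gen _ (centralizer _)) => g sg; exact: small_comm.
Qed.

(** Exchanging two copies of [B ⊔ C] is exchanging those of [B], which fixes [C],
    and then those of [C], which fixes [B]. *)
Lemma swap_along_split P B C Y (a : hom ((B ⊔ C) ⊔ ((B ⊔ C) ⊔ Y)) P) :
  exists (f g : hom P P) Q Q' (b : hom (B ⊔ Q) P) (c : hom (C ⊔ Q') P),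
    [/\ swap_along a = f ∘ g, fixes c f & fixes b g].
Proof.
have [d dE] := gswap_sum B C Y; have [a' a'E] : exists a', a' = a ∘ d by exists (a ∘ d).
pose g := a' ∘ (idm B ⊞ (idm B ⊞ gswap C C Y)) ∘ ginv a'.
exists (swap_along a'), g, _, _, a',
  (a' ∘ grot _ B B ∘ gassoc C (C ⊔ Y) (B ⊔ B)); split.
- have e : swap_along a ∘ a' = a' ∘ gswap B B _ ∘ (idm B ⊞ (idm B ⊞ gswap C C Y)).
    by rewrite a'E compmA swap_alongE -!compmA dE.
  by rewrite -[LHS]compm1 -(gfV a') compmA e /g /swap_along -!compmA gVfA.
- exact/fixes_assoc/swap_along_fixes.
apply/fixesP; exists (idm B ⊞ gswap C C Y).
by rewrite /g -!compmA gVf compm1.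
Qed.

(** The automorphism [f] keeps [U] inside [R], moves [V] out of [R], moves [W] into
    [R] and keeps [Z] out of [R]. Thus the image of [Z] is disjoint from [R] and from
    the image of [R]. The copy of [R] that it contains is exchanged first with the
    image of [R], by the swap along [a1], then with [R] itself, by the swap along
    [a2]. The detour through this copy is needed because [R] and its image may
    overlap. *)
Lemma move_back P R P' U V W X Z (e : hom (R ⊔ P') P) (f : hom P P)
    (q : hom (U ⊔ V) R) (c : hom (W ⊔ Z) P') (q' : hom (U ⊔ W) R)
    (c' : hom (V ⊔ Z) P') (z : hom (R ⊔ X) Z) :
  f ∘ e ∘ (q ⊞ c) = e ∘ (q' ⊞ c') ∘ gmid U V W Z ->
  exists Y1 Y2 (a1 : hom (R ⊔ (R ⊔ Y1)) P) (a2 : hom (R ⊔ (R ⊔ Y2)) P),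
    fixes e (swap_along a2 ∘ swap_along a1 ∘ f).
Proof.
move=> fe.
pose a1 := f ∘ e ∘ (idm R ⊞ (c ∘ (idm W ⊞ z) ∘ gswap R W X)).
pose a2 := e ∘ (idm R ⊞ (c' ∘ (idm V ⊞ z) ∘ gswap R V X)).
exists _, _, a1, a2; rewrite /fixes.
have ea2 : emb a2 = emb e by exact: emb_pre.
have ea1 : emb (f ∘ e) = emb a1 by rewrite emb_pre.
rewrite -(compmA _ f e) -(compmA _ _ (f ∘ e)) -ea2; apply: swap_along_emb.
rewrite (swap_along_emb' ea1).
(* Up to the parametrization of the complement, both sides embed [R] as the copy
   inside [Z]. *)
have a1E : a1 ∘ gswap R R (W ⊔ X) =
    e ∘ ((q' ⊞ (c' ∘ (idm V ⊞ z) ∘ gswap R V X)) ∘ (gswap R (U ⊔ W) (V ⊔ X) ∘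
      (idm R ⊞ (gmid U V W X ∘ (ginv q ⊞ idm (W ⊔ X)))))).
  have -> : a1 = f ∘ e ∘ (q ⊞ c) ∘
      (ginv q ⊞ (idm W ⊞ z) ∘ gswap R W X).
    by rewrite /a1 -!compmA -!gsum_comp gfV.
  rewrite fe.
  have -> : (ginv q ⊞ (idm W ⊞ z) ∘ gswap R W X) =
      (idm (U ⊔ V) ⊞ (idm W ⊞ z)) ∘ ((idm (U ⊔ V) ⊞ gswap R W X) ∘ (ginv q ⊞ idm _)).
    by rewrite -!gsum_comp !comp1m compm1.
  have nat : gmid U V W Z ∘ (idm (U ⊔ V) ⊞ (idm W ⊞ z)) =
      (idm (U ⊔ W) ⊞ (idm V ⊞ z)) ∘ gmid U V W (R ⊔ X).
    by rewrite -!gsum_id gmid_nat.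
  rewrite -!compmA -(gsum_id R (W ⊔ X)) -gswap_nat (compmA (gmid U V W Z)) nat.
  rewrite -!compmA (compmA (gmid U V W (R ⊔ X))) (compmA (_ ∘ _) (gswap _ _ _)).
  rewrite -(compmA (gmid _ _ _ _)) gmid_gswap_front -!compmA !gsumA !compm1.
  by rewrite -gsum_comp comp1m -!compmA.
have a2E : a2 ∘ gswap R R (V ⊔ X) =
    e ∘ ((q' ⊞ (c' ∘ (idm V ⊞ z) ∘ gswap R V X)) ∘ (gswap R (U ⊔ W) (V ⊔ X) ∘
      (idm R ⊞ (ginv q' ⊞ idm (V ⊔ X))))).
  rewrite gswap_nat gsumA /a2 gsum_id gfV compm1.
  by rewrite -compmA.
by rewrite a1E a2E !compmA !emb_pre.
Qed.

End Displacement.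

(** * S-assemblers *)

Section SCase.
Variable A : assembler.
Implicit Types B C D E P Q R S U V W X Y Z : Gcat A.
Local Notation "P ⊔ Q" := (tsum P Q : Gcat A).
Local Notation "f ⊞ g" := (gsum f g).
Local Notation "∅" := (tempty A : Gcat A).

Lemma nonempty_summand P Q R : P ⊔ Q ≃ R -> ~ R ≃ ∅ -> ~ P ≃ ∅ \/ ~ Q ≃ ∅.
Proof.
move=> PQR nR; apply/not_andP => -[P0 Q0]; apply: nR.
by apply: iso_trans (iso_sym PQR) _; exact: iso_empty_sum.
Qed.

Hypothesis AS : S_assembler A.

Definition fixes_nonempty P (f : hom P P) : Prop :=
  exists C Q (e : hom (C ⊔ Q) P), ~ C ≃ ∅ /\ fixes e f.

(** A nonempty [C] contains a copy of anything, by (S); an empty [Q] takes no space. *)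
Lemma nonempty_room C Q : ~ C ≃ ∅ -> exists Y : Gcat A, Q ⊔ (Q ⊔ Y) ≃ C.
Proof.
move=> nC; have [Q0|nQ] := pselect (Q ≃ ∅).
  exists C; apply: (iso_trans (iso_empty_left _ Q0)); exact: iso_empty_left.
have nQQ : ~ Q ⊔ Q ≃ ∅ by move=> /iso_empty_summand.
have [Y [_ /isoP[y _]]] := AS nQQ nC; exists Y; apply/isoP.
by exists (y ∘ gassoc Q Q Y).
Qed.

Section Commute.
Variables (G : groupType) (P : Gcat A) (psi : hom P P -> G).
Hypothesis psiM : composition_morphism psi.

Lemma commute_of_common_fixed C Q Q' (e : hom (C ⊔ Q) P) (e' : hom (C ⊔ Q') P) f g :
  ~ C ≃ ∅ -> fixes e f -> fixes e' g -> emb e = emb e' ->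
  commute_mod (psi f) (psi g).
Proof.
move=> nC fe ge' ee'; have [Y room] := nonempty_room Q nC.
by apply: (commute_of_room psiM fe (fixes_emb (esym ee') ge') room).
Qed.

(** If the fixed parts [C1] and [C2] meet in a nonempty [U], this is
    [commute_of_common_fixed]. Otherwise [C2] is essentially [W], a piece of [Q1]
    that also embeds in [C1] with a nonempty complement [X]. Let [u] exchange [W]
    with its copy in [C1]. Both [u] and [f] fix [X], and the conjugate of [f] by [u]
    fixes the original [W], as does [g]. *)
Lemma nonempty_commute f g : fixes_nonempty f -> fixes_nonempty g ->
  commute_mod (psi f) (psi g).
Proof.
move=> [C1 [Q1 [e1 [nC1 fe1]]]] [C2 [Q2 [e2 [nC2 ge2]]]].
have [U [V [W [Z [c1 [q1 [c2 [q2 e12]]]]]]]] := common_refinement e1 e2.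
have fU := fixes_assoc (fixes_pre c1 q1 fe1).
have gU := fixes_assoc (fixes_pre c2 q2 ge2).
have [U0|nU] := pselect (U ≃ ∅); last first.
  apply: (commute_of_common_fixed nU fU gU).
  by rewrite e12 -compmA gmid_gassoc compmA emb_pre.
have nW : ~ W ≃ ∅.
  have /nonempty_summand/(_ nC2)[] // : U ⊔ W ≃ C2 by apply/isoP; exists c2.
have [X [nX /isoP[c _]]] := AS nW nC1.
have [a aE] : exists a, a = e1 ∘ (c ⊞ q1) ∘ gassoc W X (W ⊔ Z) ∘ (idm W ⊞ gswap W X Z).
  by eexists.
pose u := swap_along a.
(* [k] is the original copy of [W], inside [Q1]. *)
pose k := e1 ∘ (idm C1 ⊞ q1) ∘ gswap W C1 Z.
have fa : fixes a f by rewrite aE; exact/fixes_pre/fixes_assoc/fixes_pre.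
have ak : emb (a ∘ gswap W W (X ⊔ Z)) = emb k.
  by rewrite aE -!compmA gswap_second_copy !compmA emb_pre emb_second.
have uX : fixes (a ∘ grot (X ⊔ Z) W W ∘ gassoc X Z (W ⊔ W)) u.
  exact/fixes_assoc/swap_along_fixes.
have fX : fixes (e1 ∘ ((c ∘ gbraid X W) ⊞ q1) ∘ gassoc X W (W ⊔ Z)) f.
  exact/fixes_assoc/fixes_pre.
apply: (commute_mod_conj (u := psi u)).
  apply: commute_of_common_fixed nX uX fX _.
  rewrite aE -!compmA gassoc_grot_front (compmA _ (gassoc X W _)) !compmA emb_pre.
  by rewrite -(compmA e1) -gsum_comp compm1.
have -> : (psi u * psi f * (psi u)^-1)%g = psi (u ∘ f ∘ ginv u).
  by rewrite !psiM (composition_morphismV psiM).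
have gW : fixes (e2 ∘ (c2 ∘ gbraid W U ⊞ q2) ∘ gassoc W U (V ⊔ Z)) g.
  exact/fixes_assoc/fixes_pre.
apply: commute_of_common_fixed nW (fixes_conj u fa) gW _.
rewrite swap_alongE ak.
have -> : e2 ∘ (c2 ∘ gbraid W U ⊞ q2) = e2 ∘ (c2 ⊞ q2) ∘ (gbraid W U ⊞ idm (V ⊔ Z)).
  by rewrite -compmA -gsum_comp compm1.
by rewrite -(compmA _ (_ ⊞ _)) -gmid_third_front !compmA -e12 emb_pre emb_second.
Qed.

End Commute.

(** Split [R] into two nonempty parts: each of them is fixed when only the copies
    of the other are exchanged. *)
Lemma swap_along_generated P (N : hom P P -> Prop) R Y (a : hom (R ⊔ (R ⊔ Y)) P) :
  is_subgroup N -> (forall f, fixes_nonempty f -> N f) -> ~ R ≃ ∅ ->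
  N (swap_along a).
Proof.
move=> [_ NM _] small nR; have [R' [nR' /isoP[r _]]] := AS nR nR.
have [d dE] : exists d, d = a ∘ (r ⊞ (r ⊞ idm Y)) by eexists.
have -> : swap_along a = swap_along d.
  rewrite /swap_along dE ginvM -!compmA [in RHS](compmA (r ⊞ _)) -gswap_nat.
  by rewrite -compmA gfVA.
have [f [g [Q [Q' [b [c [-> cf bg]]]]]]] := swap_along_split d.
by apply: NM; apply: small; [exists R', Q', c|exists R, Q, b].
Qed.

(** Decompose [P] into a first part, which is a copy of [P], and a nonempty [P'].
    If [f] keeps a nonempty part [Z] of [P'] inside [P'], then (S) finds in [Z] the
    further copy of the first part that [move_back] needs. Otherwise [P'] is the
    image of a piece [V] of the first part, and [f] followed by the exchange of
    [V] with its image fixes [V]. *)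
Lemma nonempty_generate P (N : hom P P -> Prop) : ~ P ≃ ∅ ->
  is_subgroup N -> (forall f, fixes_nonempty f -> N f) -> forall f, N f.
Proof.
move=> nP gN small f.
(* By (S), [P] contains a proper copy of itself, with nonempty complement [P']. *)
have [P' [nP' /isoP[e _]]] := AS nP nP.
have swapN R Y (a : hom (R ⊔ (R ⊔ Y)) P) : ~ R ≃ ∅ -> N (swap_along a).
  exact: swap_along_generated.
have [U [V [W [Z [q [c [q' [c' ee]]]]]]]] := common_refinement (f ∘ e) e.
have [Z0|nZ] := pselect (Z ≃ ∅); last first.
  have [X [_ /isoP[z _]]] := AS nP nZ.
  have [Y1 [Y2 [a1 [a2 fixe]]]] := move_back z ee.
  apply: (subgroup_cancel (f := swap_along a1) gN); first exact: swapN.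
  apply: (subgroup_cancel (f := swap_along a2) gN); first exact: swapN.
  apply: small; exists P, P', e; split=> //.
  by rewrite (compmA (swap_along a2)).
have nV : ~ V ≃ ∅.
  by have /nonempty_summand/(_ nP')[] : V ⊔ Z ≃ P' by apply/isoP; exists c'.
have [a aE] : exists a, a = e ∘ (q ⊞ c') ∘
    (gassoc U V (V ⊔ Z) ∘ gswap V U (V ⊔ Z)) ∘ (idm V ⊞ gswap V U Z) by eexists.
apply: (subgroup_cancel (f := swap_along a) gN); first exact: swapN.
apply: small; exists V, _, a; split=> //; rewrite /fixes -(compmA (swap_along a)).
apply: swap_along_emb.
have -> : emb (f ∘ a) = emb (e ∘ (idm P ⊞ c') ∘ gswap V P Z).
  have -> : f ∘ a = f ∘ e ∘ (q ⊞ c) ∘ (gassoc U V (W ⊔ Z) ∘ gswap V U (W ⊔ Z)) ∘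
      (idm V ⊞ ((idm U ⊞ (ginv c ∘ c')) ∘ gswap V U Z)).
    have -> : idm V ⊞ (idm U ⊞ ginv c ∘ c') ∘ gswap V U Z =
        (idm V ⊞ (idm U ⊞ ginv c ∘ c')) ∘ (idm V ⊞ gswap V U Z).
      by rewrite -gsum_comp comp1m.
    rewrite aE -!compmA (compmA (gswap V U (W ⊔ Z))) gswap_nat.
    rewrite -!compmA (compmA (gassoc U V (W ⊔ Z))) gassoc_nat.
    by rewrite -!compmA gsumA gsum_id compm1 gfVA.
  by rewrite emb_pre ee -!compmA gmid_second_front !compmA emb_pre emb_second.
have -> : a ∘ gswap V V (U ⊔ Z) = e ∘ (q ⊞ c') ∘ gswap V (U ⊔ V) Z ∘
    (idm V ⊞ (gassoc U V Z ∘ gswap V U Z)).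
  by rewrite aE -!compmA gswap_second_copy_right.
by rewrite emb_pre emb_second.
Qed.

End SCase.

(** * EA-assemblers *)

Section OrderedGroup.
Local Open Scope ring_scope.
Variable R : porderZmodType.
Hypothesis oR : ordered_group R.
Implicit Types x y z t : R.

Lemma ordered_leD x y z t : x <= y -> z <= t -> x + z <= y + t.
Proof.
move=> xy zt; apply: (le_trans (oR z xy)).
by rewrite ![y + _]addrC; exact: oR.
Qed.

Lemma ordered_ltD x y z : x < y -> x + z < y + z.
Proof.
by rewrite !lt_neqAle => /andP[xy xley]; rewrite (inj_eq (addIr z)) xy oR.
Qed.

Lemma ordered_ltDI x y z : x + z < y + z -> x < y.
Proof. by move=> /(ordered_ltD (- z)); rewrite !addrK. Qed.

Lemma ordered_lt_double x : 0 < x -> x < x + x.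
Proof. by move=> x0; rewrite -[ltLHS]add0r; exact: ordered_ltD. Qed.

Lemma ordered_sum_ge0 (I : finType) (F : I -> R) :
  (forall i, 0 <= F i) -> 0 <= \sum_i F i.
Proof.
move=> F0; elim/big_ind: _ => // x y x0 y0.
by rewrite -[leLHS]addr0; exact: ordered_leD.
Qed.

Lemma ordered_sum_gt0 (I : finType) (F : I -> R) :
  (forall i, 0 <= F i) -> 0 < \sum_i F i -> exists i, 0 < F i.
Proof.
move=> F0 sF; apply/not_existsP => nF; move: sF; rewrite big1 ?ltxx // => i _.
by apply/eqP; apply/negP => Fi; apply: (nF i); rewrite lt_def F0 andbT; exact/negP.
Qed.

End OrderedGroup.

Section Volumes.
Local Open Scope ring_scope.
Variables (A : assembler) (R : porderZmodType) (vol : A -> R).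
Hypothesis vol_fun : volume_function vol.
Hypothesis oR : ordered_group R.
Local Notation "P ⊔ Q" := (tsum P Q : Gcat A).
Local Notation tvol := (tvol vol).

Lemma tvol_ge0 (P : ftuple A) : 0 <= tvol P.
Proof. by apply: ordered_sum_ge0 => // i; exact: vol_fun.1. Qed.

Lemma tvol_sum (P Q : ftuple A) : tvol (tsum P Q) = tvol P + tvol Q.
Proof. exact: big_sumType. Qed.

Lemma tvol_subtuple (T : ftuple A) (p : pred (idx T)) :
  tvol (subtuple p) = \sum_(i | p i) vol (piece T i).
Proof. by symmetry; exact: (big_sub p). Qed.

Lemma tvol_whom (P Q : ftuple A) (f : whom P Q) : tvol P = tvol Q.
Proof.
rewrite /tvol (partition_big (wmap f) predT) //=; apply: eq_bigr => j _.
rewrite (vol_fun.2 _ _ _ _ (wcover f j)).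
exact: (big_sub (fun i => wmap f i == j)).
Qed.

Lemma tvol_iso (P Q : Gcat A) : P ≃ Q -> tvol P = tvol Q.
Proof.
move=> /isoP[f _]; have [[T l r] _] := fracP f.
by rewrite -(tvol_whom l) -(tvol_whom r).
Qed.

End Volumes.

Section Peel.
Variables (A : assembler) (S : ftuple A) (p : pred (idx S)).

Definition peel_map (x : idx (tsum (subtuple p) (subtuple (fun i => ~~ p i)))) : idx S :=
  match x with inl i => val i | inr j => val j end.

Definition peel_arr x : hom
    (piece (tsum (subtuple p) (subtuple (fun i => ~~ p i))) x) (piece S (peel_map x)) :=
  match x with
  | inl i => idm (piece (subtuple p) i)
  | inr j => idm (piece (subtuple (fun i => ~~ p i)) j)
  end.

Lemma subtuple_compl : tsum (subtuple p) (subtuple (fun i => ~~ p i)) ≃ S.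
Proof.
apply/isoP; eexists; last exact: I; apply: gof; apply: (relabel (f := peel_arr)).
- case=> [[x px]|[x px]] [[y py]|[y py]] /= xy; subst y;
    by [rewrite (bool_irrelevance px py)|exfalso; move: px py; case: (p x)].
- move=> i; case pi: (p i); first by exists (inl (exist _ i pi)).
  by have npi : ~~ p i; [rewrite pi|exists (inr (exist _ i npi))].
- by case=> x; exists (idm _); rewrite comp1m.
Qed.

End Peel.

Section EACase.
Local Open Scope ring_scope.
Variables (A : assembler) (R : porderZmodType) (vol : A -> R).
Hypothesis EA : EA_assembler vol.
Implicit Types P Q C D K M : Gcat A.
Local Notation "P ⊔ Q" := (tsum P Q : Gcat A).
Local Notation "f ⊞ g" := (gsum f g).
Local Notation "∅" := (tempty A : Gcat A).
Local Notation tvol := (tvol vol).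

Let oR : ordered_group R. Proof. by have [] := EA. Qed.
Let vol_fun : volume_function vol. Proof. by have [] := EA. Qed.

Lemma embed_smaller P Q : tvol P < tvol Q -> exists P', P ⊔ P' ≃ Q.
Proof. by have [_ _ + _] := EA; apply. Qed.

Lemma small_pieces (P Q : Gcat A) : 0 < tvol P ->
  exists S : Gcat A, S ≃ Q /\ forall i : idx S, vol (piece S i) *+ 2 <= tvol P.
Proof.
move=> P0; have [_ _ _ /(_ P P0 Q)[S [f Sf]]] := EA.
by exists S; split=> //; apply/isoP; exists (gof f).
Qed.

Lemma tvol_singleton (S : ftuple A) i : tvol (subtuple (pred1 i)) = vol (piece S i).
Proof. by rewrite tvol_subtuple big_pred1_eq. Qed.

(** The volumes of the pieces of [P] given by (A) add up to that of [P], so that one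
    of them is positive. *)
Lemma halve P : 0 < tvol P ->
  exists Q Q', [/\ Q ⊔ Q' ≃ P, 0 < tvol Q & tvol Q *+ 2 <= tvol P].
Proof.
move=> P0; have [S [SP Ssmall]] := small_pieces P P0.
have [i vi] : exists i, 0 < vol (piece S i).
  apply: ordered_sum_gt0 => [i|]; first exact: vol_fun.1.
  by rewrite -/(tvol S) (tvol_iso vol_fun SP).
exists (subtuple (pred1 i)), (subtuple (fun j => ~~ pred1 i j)).
by rewrite tvol_singleton; split=> //; apply: iso_trans (subtuple_compl _) SP.
Qed.

Lemma eighth P : 0 < tvol P ->
  exists Q Q', [/\ Q ⊔ Q' ≃ P, 0 < tvol Q & tvol Q *+ 8 <= tvol P].
Proof.
have double (x y z : R) n : x *+ 2 <= y -> y *+ n <= z -> x *+ (2 * n) <= z.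
  move=> xy; apply: le_trans; elim: n => [|n IHn]; first by rewrite muln0.
  by rewrite mulnS mulrnDr [leRHS]mulrS; exact: ordered_leD.
move=> /halve[Q1 [Q1' [i1 v1 h1]]]; have [Q2 [Q2' [i2 v2 h2]]] := halve v1.
have [Q3 [Q3' [i3 v3 h3]]] := halve v2.
exists Q3, (Q3' ⊔ (Q2' ⊔ Q1')); split=> //.
  have id (X : Gcat A) : X ≃ X by apply/isoP; exists (idm X).
  apply: iso_trans i1; apply: iso_trans (iso_sum i2 (id _)).
  apply: iso_trans (iso_sum (iso_sum i3 (id _)) (id _)).
  apply/isoP; exists ((gassoc Q3 Q3' Q2' ⊞ idm Q1') ∘ gassoc Q3 (Q3' ⊔ Q2') Q1' ∘
    (idm Q3 ⊞ gassoc Q3' Q2' Q1')); by [].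
by apply: (double _ _ _ 4 h3); apply: (double _ _ _ 2 h2).
Qed.

Variables (P B : Gcat A).
Hypothesis B_gt0 : 0 < tvol B.
Hypothesis B_small : tvol B *+ 8 <= tvol P.

Definition moves_little (f : hom P P) : Prop :=
  exists C Q (e : hom (C ⊔ Q) P), tvol Q <= tvol B /\ fixes e f.

(** The common fixed part [U] has complement [Q] of volume at most twice that of [B],
    so six times the volume of [B] bounds that of three copies of [Q]. The
    factor eight makes the comparison with the volume of [P] strict, as (E) requires
    for two copies of [Q] to fit in [U]. *)
Lemma moves_little_commute (G : groupType) (psi : hom P P -> G) f g :
  composition_morphism psi -> moves_little f -> moves_little g ->
  commute_mod (psi f) (psi g).
Proof.
move=> psiM [C1 [Q1 [e1 [sQ1 fe1]]]] [C2 [Q2 [e2 [sQ2 ge2]]]].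
have [U [V [W [Z [c1 [q1 [c2 [q2 e12]]]]]]]] := common_refinement e1 e2.
have fU := fixes_assoc (fixes_pre c1 q1 fe1).
have gU := fixes_assoc (fixes_pre c2 q2 ge2).
have gU' : fixes (e1 ∘ (c1 ⊞ q1) ∘ gassoc U V (W ⊔ Z)) g.
  by apply: fixes_emb gU; rewrite e12 -(compmA _ (gmid _ _ _ _)) gmid_gassoc compmA emb_pre.
pose Q := V ⊔ (W ⊔ Z).
have vP : tvol U + tvol Q = tvol P.
  rewrite -tvol_sum; apply: (tvol_iso vol_fun).
  by apply/isoP; exists (e1 ∘ (c1 ⊞ q1) ∘ gassoc U V (W ⊔ Z)).
have vQ : tvol Q <= tvol B + tvol B.
  rewrite tvol_sum; apply: ordered_leD => //.
    apply: le_trans sQ2.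
    have <- : tvol (V ⊔ Z) = tvol Q2 by apply: (tvol_iso vol_fun); apply/isoP; exists q2.
    by rewrite tvol_sum -[leLHS]addr0; apply: ordered_leD => //; exact: tvol_ge0.
  have -> // : tvol (W ⊔ Z) = tvol Q1.
  by apply: (tvol_iso vol_fun); apply/isoP; exists q1.
have [Y /isoP[y _]] : exists Y, (Q ⊔ Q) ⊔ Y ≃ U.
  apply: embed_smaller; apply: (ordered_ltDI oR (z := tvol Q)); rewrite vP.
  apply: lt_le_trans B_small; rewrite tvol_sum.
  apply: (le_lt_trans (y := tvol B *+ 6)).
    rewrite [_ *+ 6](mulrnDr _ 4 2) [_ *+ 4](mulrnDr _ 2 2) mulr2n.
    by do 2 apply: ordered_leD => //.
  rewrite -[_ *+ 6]add0r [_ *+ 8](mulrnDr _ 2 6); apply: ordered_ltD => //.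
  by apply: (lt_trans B_gt0); exact: ordered_lt_double.
apply: (commute_of_room psiM fU gU' (Y := Y)).
by apply/isoP; exists (y ∘ gassoc Q Q Y).
Qed.

Section Generation.
Variable N : hom P P -> Prop.
Hypothesis gN : is_subgroup N.
Hypothesis smallN : forall f, moves_little f -> N f.

(** Quantifying over all embeddings of [M] lets the induction on [M] keep [P]
    and [N] unchanged. *)
Definition contains_aut (M : Gcat A) : Prop :=
  forall (K : Gcat A) (e : hom (K ⊔ M) P) (f : hom M M),
    N (e ∘ (idm K ⊞ f) ∘ ginv e).

Lemma contains_aut_iso M M' :
  M ≃ M' -> contains_aut M -> contains_aut M'.
Proof.
move=> /isoP[m _] gM K e f.
have -> : e ∘ (idm K ⊞ f) ∘ ginv e =
    (e ∘ (idm K ⊞ m)) ∘ (idm K ⊞ (ginv m ∘ f ∘ m)) ∘ ginv (e ∘ (idm K ⊞ m)).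
  rewrite ginvM ginv_sum ginv1 -!compmA !gsumA !comp1m.
  by rewrite -!compmA gfV compm1 gfVA.
exact: gM.
Qed.

Lemma fixes_extend K M C Q (e : hom (K ⊔ M) P) (b : hom (C ⊔ Q) M) f :
  fixes b f -> fixes (e ∘ (idm K ⊞ b) ∘ ginv (gassoc K C Q))
    (e ∘ (idm K ⊞ f) ∘ ginv e).
Proof.
move=> /fixesP[s fb]; apply/fixesP; exists s.
rewrite -!compmA gVfA gsumA comp1m fb -gsum_id.
have nat : ginv (gassoc K C Q) ∘ ((idm K ⊞ idm C) ⊞ s) =
    (idm K ⊞ (idm C ⊞ s)) ∘ ginv (gassoc K C Q).
  rewrite -[LHS]compm1 -(gfV (gassoc K C Q)) -!compmA (compmA (_ ⊞ s)) -gassoc_nat.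
  by rewrite -!compmA gVfA.
by rewrite nat gsumA comp1m.
Qed.

Lemma contains_aut_small : contains_aut B.
Proof.
move=> K e f; apply: smallN; exists K, B, e; split=> //.
by apply/fixesP; exists f; rewrite -!compmA gVf compm1.
Qed.

(** Apply [move_back] to [D] inside [D ⊔ M]: the part of [D ⊔ M] disjoint from [D] and
    from its image has at least the volume of [M] less that of [D], which leaves
    room for one more copy of [D]. What remains is an automorphism of [M]. *)
Lemma contains_aut_add M D :
  tvol D + tvol D < tvol B -> tvol B <= tvol M ->
  contains_aut M -> contains_aut (D ⊔ M).
Proof.
move=> Dsmall Mbig gM K e f.
have [U [V [W [Z [q [c [q' [c' ee]]]]]]]] :=
  common_refinement (f ∘ idm (D ⊔ M)) (idm (D ⊔ M)).
have [X /isoP[z _]] : exists X, D ⊔ X ≃ Z.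
  apply: embed_smaller; apply: (ordered_ltDI oR (z := tvol V)).
  have -> : tvol Z + tvol V = tvol M.
    rewrite addrC -tvol_sum; apply: (tvol_iso vol_fun).
    by apply/isoP; exists c'.
  apply: (lt_le_trans _ Mbig); apply: (le_lt_trans _ Dsmall).
  apply: ordered_leD => //.
  have <- : tvol (U ⊔ V) = tvol D by apply: (tvol_iso vol_fun); apply/isoP; exists q.
  by rewrite tvol_sum -[leLHS]add0r; apply: ordered_leD => //; exact: tvol_ge0.
have [Y1 [Y2 [a1 [a2 /fixesP[s fixe]]]]] := move_back z ee.
pose lift (h : hom (D ⊔ M) (D ⊔ M)) := e ∘ (idm K ⊞ h) ∘ ginv e.
have liftM h k : lift (h ∘ k) = lift h ∘ lift k.
  by rewrite /lift -!compmA gVfA gsumA comp1m.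
have swapN Y (a : hom (D ⊔ (D ⊔ Y)) (D ⊔ M)) : N (lift (swap_along a)).
  have lift_fixes := fixes_extend e (swap_along_fixes a).
  apply: smallN; exists (K ⊔ Y), (D ⊔ D); eexists; split; last exact: lift_fixes.
  by rewrite tvol_sum; exact: ltW.
apply: (subgroup_cancel (f := lift (swap_along a1)) gN); first exact: swapN.
apply: (subgroup_cancel (f := lift (swap_along a2)) gN); first exact: swapN.
rewrite -/(lift f) -!liftM (compmA (swap_along a2)).
have -> : swap_along a2 ∘ swap_along a1 ∘ f = idm D ⊞ s.
  by rewrite -[LHS]compm1 fixe comp1m.
have -> : lift (idm D ⊞ s) = (e ∘ ginv (gassoc K D M)) ∘
    (idm (K ⊔ D) ⊞ s) ∘ ginv (e ∘ ginv (gassoc K D M)).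
  rewrite /lift ginvM ginvK -!compmA -(gsum_id K D); congr (e ∘ _).
  by rewrite (compmA _ (gassoc K D M)) -gassoc_nat -compmA gVfA.
exact: gM.
Qed.

Lemma contains_aut_tuple (S : Gcat A) :
  (forall i : idx S, vol (piece S i) + vol (piece S i) < tvol B) ->
  contains_aut (S ⊔ B).
Proof.
have [n] := ubnP #|{: fin_sort (idx S)}|; elim: n S => // n IHn S; rewrite ltnS => cardS Ssmall.
have [i _|S0] := pickP (fun i : idx S => true); last first.
  apply: contains_aut_iso (contains_aut_small).
  suff /isoP[t _] : ∅ ≃ S.
    by apply/isoP; exists ((t ⊞ idm B) ∘ ginv (glunit B)).
  apply/isoP; unshelve eexists; last exact: I; apply: gof.
  by apply: (relabel (phi := fun v : idx (tempty A) => match v with end)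
    (f := fun v : idx (tempty A) => match v with end)) => [[]|i|[]]; have := S0 i.
apply: (@contains_aut_iso
  (subtuple (pred1 i) ⊔ (subtuple (fun j => ~~ pred1 i j) ⊔ B))).
  have /isoP[s _] := subtuple_compl (pred1 i).
  by apply/isoP; exists ((s ⊞ idm B) ∘ gassoc _ _ B).
apply: contains_aut_add.
- by rewrite tvol_singleton.
- by rewrite tvol_sum -[leLHS]add0r; apply: ordered_leD => //; exact: tvol_ge0.
apply: IHn => [|[j ij]]; last exact: Ssmall.
have -> : #|{: fin_sort (idx (subtuple (fun j => ~~ pred1 i j)))}| = #|predC1 i| by exact: card_sig.
apply: leq_trans cardS; rewrite [X in (_ < X)%N](cardD1 i) inE add1n ltnS.
by apply: eq_leq; apply: eq_card => j; rewrite !inE andbT.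
Qed.

End Generation.

(** Cut the complement of [B] into pieces that are tiny compared with [B]. The scale
    in (A) is a part [B1] of [B] of at most half its volume, in order to get a
    strict inequality. *)
Lemma moves_little_generate N : (exists C, B ⊔ C ≃ P) ->
  is_subgroup N -> (forall f, moves_little f -> N f) -> forall f, N f.
Proof.
move=> [C BCP] gN smallN f.
have [B1 [B2 [_ B1_gt0 B1B]]] := halve B_gt0.
have [S [SC Ssmall]] := small_pieces C B1_gt0.
have gen : contains_aut N (S ⊔ B).
  apply: contains_aut_tuple => // i; rewrite -mulr2n.
  apply: (le_lt_trans (Ssmall i)); apply: lt_le_trans B1B.
  exact: ordered_lt_double.
have [m _] : exists m : hom (S ⊔ B) P, True.
  move: BCP SC => /isoP[p _] /isoP[c _].
  by exists (p ∘ (idm B ⊞ c) ∘ gbraid S B).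
(* [contains_aut] is used with nothing beside [S ⊔ B]. *)
pose e := m ∘ grunit (S ⊔ B) ∘ gbraid ∅ (S ⊔ B).
have -> : f = e ∘ (idm ∅ ⊞ (ginv m ∘ f ∘ m)) ∘ ginv e.
  rewrite -[LHS]compm1 -(gfV e) compmA; congr (_ ∘ _).
  rewrite /e -[RHS]compmA gbraid_nat [RHS]compmA -(compmA m _ (_ ⊞ _)) grunit_nat -!compmA.
  by rewrite gfVA.
exact: gen.
Qed.

End EACase.

(** * Automorphisms in [UGcat] *)

Section UGAutomorphisms.
Variables (A : assembler) (P : Gcat A).
Local Notation "P ⊔ Q" := (tsum P Q : Gcat A).
Local Notation "f ⊞ g" := (gsum f g).

Definition ug_of (f : hom P P) : UGhom P P := ug_pi (Embedding (f ∘ grunit P)).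

Lemma ug_of1 : ug_of (idm P) = ug_id P.
Proof. by rewrite /ug_of comp1m. Qed.

Lemma ug_ofM f g : ug_of (f ∘ g) = ug_comp (ug_of f) (ug_of g).
Proof.
rewrite ug_comp_pi; symmetry; apply/ug_piP; exists (grunit (tempty A)).
change (f ∘ g ∘ grunit P ∘ (idm P ⊞ grunit (tempty A)) =
  f ∘ grunit P ∘ ((g ∘ grunit P) ⊞ idm (tempty A : Gcat A)) ∘
    gassoc P (tempty A) (tempty A)).
by rewrite -(compmA f (grunit P)) grunit_nat -grunit_assoc -!compmA.
Qed.

Lemma ug_ofV f : ug_comp (ug_of (ginv f)) (ug_of f) = ug_id P.
Proof. by rewrite -ug_ofM gVf ug_of1. Qed.

Lemma ug_ofVr f : ug_comp (ug_of f) (ug_of (ginv f)) = ug_id P.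
Proof. by rewrite -ug_ofM gfV ug_of1. Qed.

Definition ug_aut (f : hom P P) : aut (P : UGcat A) :=
  @Aut (UGcat A) P (ug_of f) (ug_of (ginv f)) (ug_ofV f) (ug_ofVr f).

Lemma ug_autM : composition_morphism ug_aut.
Proof. by move=> f g; apply: aut_ext; exact: ug_ofM. Qed.

(** The complement of an isomorphism of [UGcat] is a summand of the complement of
    the identity, hence empty. *)
Lemma ug_aut_surj (x : aut (P : UGcat A)) : exists f, ug_aut f = x.
Proof.
have [e xe] := ugP (aut_hom x); have [e' xe'] := ugP (aut_inv x).
have : ug_comp (aut_inv x) (aut_hom x) = ug_id P := aut_invK x.
rewrite xe xe' ug_comp_pi => /ug_piP[s _].
have /iso_sym/isoP[c _] : complement e ≃ tempty A.
  by apply: (@iso_empty_summand _ _ (complement e')); apply/isoP; exists s.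
exists (emb_map e ∘ ((idm P ⊞ c) ∘ ginv (grunit P))); apply: aut_ext.
rewrite xe; apply/ug_piP; exists c.
change (emb_map e ∘ (idm P ⊞ c) =
  emb_map e ∘ ((idm P ⊞ c) ∘ ginv (grunit P)) ∘ grunit P).
by rewrite -!compmA gVf compm1.
Qed.

End UGAutomorphisms.

(** * Quasi-perfectness *)

Local Open Scope ring_scope.

Theorem theorem3p20 (A : assembler) (P : UGcat A)
  (hP : (S_assembler A /\ ~ P ≃ tempty A) \/
        (exists (R : porderZmodType) (vol : A -> R),
           EA_assembler vol /\ 0 < tvol vol P)) :
  quasi_perfect (aut P).
Proof.
have psiM := @ug_autM A P; have psi_surj := @ug_aut_surj A P.
case: hP => [[AS nP]|[R [vol [EA P_gt0]]]].
  apply: (quasi_perfect_of_generation (small := @fixes_nonempty A P) psiM psi_surj).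
    by move=> N gN smallN f; apply: nonempty_generate smallN f.
  by move=> f g; exact: nonempty_commute.
have [B [C [BCP B_gt0 B_small]]] := eighth EA P_gt0.
apply: (quasi_perfect_of_generation (small := @moves_little A R vol P B) psiM psi_surj).
  move=> N gN smallN f; apply: (moves_little_generate EA B_gt0) gN smallN f.
  by exists C.
by move=> f g; exact: (moves_little_commute EA B_gt0 B_small psiM).
Qed.
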